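(* The inducibility of every tree $S$ that is neither a star nor a path is at most $1-10^{-35}$.
   Context: All trees are finite. For a tree $T$, $Z_k(T)$ denotes the number of $k$-vertex subtrees of $T$. An embedding of a tree $S$ in $T$ is a subtree of $T$ isomorphic to $S$ (so embeddings are counted as subgraphs, not as injective homomorphisms). The density $d(S,T)$ of a $k$-vertex tree $S$ in $T$ is the number of embeddings of $S$ in $T$ divided by $Z_k(T)$; if $T$ has fewer than $k$ vertices, $d(S,T)=0$. The inducibility of a tree $S$ is $\limsup_{n\to\infty}\max\{d(S,T): T \text{ is an } n\text{-vertex tree}\}$. A star is a tree having a vertex adjacent to all other vertices. *)

(* Defs.v *)
From HB Require Import structures.
From mathcomp Require Import all_boot all_order all_algebra.
From mathcomp Require Import boolp reals ereal topology normedtype sequences.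

Set Implicit Arguments.
Unset Strict Implicit.
Unset Printing Implicit Defensive.

Import Order.TTheory GRing.Theory Num.Theory.

(* A pair (vertex set, edge set) inside an ambient finite type V, so that the
   subgraphs of G : sgraph V are again elements of sgraph V.  Well-formedness
   is the separate predicate [simple_graph], which [is_tree] includes. *)
Definition sgraph (V : finType) : Type := ({set V} * {set {set V}})%type.
HB.instance Definition _ (V : finType) := Finite.on (sgraph V).

Definition vset (V : finType) (G : sgraph V) : {set V} := G.1.
Definition eset (V : finType) (G : sgraph V) : {set {set V}} := G.2.

Definition simple_graph (V : finType) (G : sgraph V) : bool :=
  [forall e in eset G, (#|e| == 2) && (e \subset vset G)].

Definition adj (V : finType) (G : sgraph V) : rel V :=
  fun x y => [set x; y]%SET \in eset G.

Definition connected_graph (V : finType) (G : sgraph V) : Prop :=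
  vset G != set0 /\ {in vset G &, forall x y, connect (adj G) x y}.

(* [ucycle] also accepts the empty sequence and [:: x; y] for an edge xy;
   the graph-theoretic cycles are those of length at least 3. *)
Definition acyclic_graph (V : finType) (G : sgraph V) : Prop :=
  forall c : seq V, ucycle (adj G) c -> size c <= 2.

Definition is_tree (V : finType) (G : sgraph V) : Prop :=
  [/\ simple_graph G, connected_graph G & acyclic_graph G].

Definition subgraph (V : finType) (H G : sgraph V) : bool :=
  (vset H \subset vset G) && (eset H \subset eset G).

Definition isomorphic (V W : finType) (G : sgraph V) (H : sgraph W) : Prop :=
  exists f : V -> W,
    [/\ {in vset G &, injective f},
        f @: vset G = vset H
      & {in vset G &, forall x y, adj G x y = adj H (f x) (f y)}].

Definition subtree (V : finType) (H T : sgraph V) : Prop :=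
  subgraph H T /\ is_tree H.

Definition Z (V : finType) (k : nat) (T : sgraph V) : nat :=
  #|[set H : sgraph V | `[< subtree H T >] && (#|vset H| == k)]|.

Definition embeddings (V W : finType) (S : sgraph V) (T : sgraph W) :
    {set sgraph W} :=
  [set H : sgraph W | `[< subtree H T /\ isomorphic S H >]].

Definition density (R : realType) (V W : finType) (S : sgraph V)
    (T : sgraph W) : R :=
  if #|vset T| < #|vset S| then 0%R
  else (#|embeddings S T|%:R / (Z #|vset S| T)%:R)%R.

(* Every n-vertex tree is represented, up to isomorphism, with vertex set
   {0, ..., n-1}.  The default value 0 is harmless, as densities are
   nonnegative; it matters only for n = 0, where there is no tree. *)
Definition max_density (R : realType) (V : finType) (S : sgraph V)
    (n : nat) : R :=
  \big[Num.max/0%R]_(T : sgraph 'I_n |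
     `[< is_tree T >] && (vset T == [set: 'I_n])) density R S T.

(* The limsup is taken in the extended reals, where it is always defined. *)
Definition inducibility (R : realType) (V : finType) (S : sgraph V) : \bar R :=
  limn_esup (fun n => (max_density R S n)%:E).

Definition is_star (V : finType) (S : sgraph V) : Prop :=
  is_tree S /\
  exists2 x, x \in vset S & {in vset S, forall y, y != x -> adj S x y}.

Definition path_graph (k : nat) : sgraph 'I_k :=
  ([set: 'I_k],
   [set [set p.1; p.2] | p : 'I_k * 'I_k & p.2 == p.1.+1 :> nat])%SET.

Definition is_path (V : finType) (S : sgraph V) : Prop :=
  exists k : nat, isomorphic (path_graph k) S.

(* Main.v *)
(** Suppose that nearly all k-vertex subtrees of a huge tree are copies of S.
    Exchanging a leaf of a copy for a vertex outside it then usually gives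
    another copy, so that it preserves the number of leaves, the sum of squared
    degrees and the Wiener index.  Let l be the number of leaves of S, and N(X)
    the number of outer neighbours of a subtree X.

    If N(X) is large compared with l for a fair share of the copies X, then the
    new leaves spread over few vertices, because the sum of distances to a
    vertex is strictly convex along paths, and the degrees force almost all
    leaves of S to hang at one vertex v.  For such S, double counting the
    exchanges that bring a leaf to v against those that take one away from v
    shows that copies are rare, since S is not a star.

    So N(X) is O(l) for most copies X.  Choose a root r lying in few copies.
    Adding to a (k-1)-vertex subtree its neighbour towards r is injective;
    hence removing a leaf of a copy and adding the neighbour towards r usually
    gives a copy.  By the Wiener index, the paths from the top of a copy to two
    leaves share a number of vertices that depends only on k, whereas a move
    towards r lengthens this common part. *)

Require Import Defs.
From mathcomp Require Import all_boot all_order all_algebra.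
From mathcomp Require Import boolp reals ereal topology normedtype sequences.
From mathcomp Require Import zify ring lra.

Set Implicit Arguments.
Unset Strict Implicit.
Unset Printing Implicit Defensive.

Import Order.TTheory GRing.Theory Num.Theory.

(** * Connected sets in a tree *)

(** Vertices of the big tree have unbounded degree, so one vertex may account for most exchanges of
    a leaf. Failed exchanges are therefore measured relative to the boundary of the copy, or to the
    outer neighbours of a fixed centre; this keeps the bounds independent of [k] and [l]. The
    threshold for hanging almost all leaves at one vertex is [17 / 20]: all leaves, less a tenth
    that may be irregular and a twentieth that may be scattered. Below it, doubling the required
    ratio N(X) / l divides the number of copies by about 100, up to an error of order [b], so the
    ratio can be pushed as far as the last phase needs. That phase chains three moves, so its
    exceptional sets are nested three deep, and each level multiplies the losses by a large
    constant. Trees are given by distances: [dist_step] expresses connectedness, [dist_edge] and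
    [step_uniq] the absence of odd and even cycles. *)

Record tree_metric (V : finType) := TreeMetric {
  edge : rel V;
  dist : V -> V -> nat;
  dist_eq0 : forall u v, (dist u v == 0) = (u == v);
  distC : forall u v, dist u v = dist v u;
  edgeE : forall u v, edge u v = (dist u v == 1);
  dist_edge : forall w u v, edge u v ->
    dist w u = (dist w v).+1 \/ dist w v = (dist w u).+1;
  dist_step : forall w u, u != w ->
    exists2 v, edge u v & dist w u = (dist w v).+1;
  step_uniq : forall w u v v', edge u v -> edge u v' ->
    dist w u = (dist w v).+1 -> dist w u = (dist w v').+1 -> v = v' }.

Section TreeMetric.
Variables (V : finType) (T : tree_metric V).
Local Notation e := (edge T).
Local Notation d := (dist T).

Implicit Types (X Y U H : {set V}) (u v w x y z : V).

Lemma distxx u : d u u = 0.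
Proof. by apply/eqP; rewrite dist_eq0. Qed.

Lemma edge_sym u v : e u v = e v u.
Proof. by rewrite !edgeE distC. Qed.

Lemma edge_irr u : e u u = false.
Proof. by rewrite edgeE distxx. Qed.

Lemma edge_neq u v : e u v -> u != v.
Proof. by apply: contraTneq => ->; rewrite edge_irr. Qed.

Lemma edge_dist u v : e u v -> d u v = 1.
Proof. by rewrite edgeE => /eqP. Qed.

(** Points from [u] towards [w]; by the default, a walk that has arrived at [w] stays there. *)
Definition step w u := odflt u [pick v | e u v && (d w u == (d w v).+1)].

Lemma stepP w u : u != w -> e u (step w u) /\ d w u = (d w (step w u)).+1.
Proof.
move=> uw; rewrite /step; case: pickP => [v /andP[? /eqP ?] //|no].
by have [v ev dv] := dist_step T uw; move: (no v); rewrite ev dv eqxx.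
Qed.

Lemma stepE w u v : e u v -> d w u = (d w v).+1 -> step w u = v.
Proof.
move=> euv dwu; have uw : u != w by rewrite -(dist_eq0 T) distC dwu.
by have [e1 d1] := stepP uw; apply: (step_uniq (w := w) e1 euv).
Qed.

Lemma step_self v y : e y v -> step v y = v.
Proof. by move=> eyv; apply: stepE; rewrite // distxx distC edge_dist. Qed.

(* In a tree, the nonempty sets with this property are the vertex sets of the
   subtrees. *)
Definition cvx X :=
  [forall w in X, forall u in X, (u != w) ==> (step w u \in X)].

Lemma cvxP X :
  reflect {in X &, forall w u, u != w -> step w u \in X} (cvx X).
Proof.
apply: (iffP forall_inP) => [h w u wX uX|h w wX].
  by move: (h w wX) => /forall_inP/(_ u uX)/implyP.
by apply/forall_inP => u uX; apply/implyP; apply: h.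
Qed.

Definition nbr X v := [set u in X | e v u].
Definition deg X v := #|nbr X v|.
Definition bd X := [set y | (y \notin X) && [exists v in X, e y v]].
Definition leaves X := [set x in X | deg X x == 1].
(* Meaningful when [y] has exactly one neighbour in [X]: [y] is a leaf of [X],
   or [X] is connected and [y] is in [bd X]. *)
Definition att X y := odflt y [pick v in X | e y v].
Definition out X v := #|nbr (~: X) v|.

Lemma in_nbr X v u : (u \in nbr X v) = (u \in X) && e v u.
Proof. by rewrite inE. Qed.

Lemma bdP X y : reflect (y \notin X /\ exists2 v, v \in X & e y v) (y \in bd X).
Proof.
rewrite inE; apply: (iffP andP) => [[yX /exists_inP[v vX ev]]|[yX [v vX ev]]].
  by split=> //; exists v.
by split=> //; apply/exists_inP; exists v.
Qed.

Lemma bd_notin X y : y \in bd X -> y \notin X.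
Proof. by case/bdP. Qed.

Lemma edge2_dist y u v : e y u -> e y v -> u != v -> d u v = 2.
Proof.
move=> yu yv uv; have := dist_edge u yv.
rewrite [d u y]distC (edge_dist yu) => -[|//].
by case => /esym/eqP; rewrite dist_eq0 (negPf uv).
Qed.

(** Two distinct neighbours of [y] have [y] on the path between them, so convexity would put [y] in
    [X]. *)
Lemma bd_uniq X y u v : cvx X -> y \notin X -> u \in X -> v \in X ->
  e y u -> e y v -> u = v.
Proof.
move=> /cvxP cX yX uX vX yu yv; apply/eqP/negPn/negP => uv.
have := cX u v uX vX; rewrite eq_sym => /(_ uv).
rewrite (@stepE u v y) ?(negPf yX) //; first by rewrite edge_sym.
by rewrite (edge2_dist yu yv uv) distC (edge_dist yu).
Qed.

Section Ext.
Variables (U : {set V}) (y : V).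
Hypotheses (cU : cvx U) (yU : y \in bd U).
Let v := att U y.

Lemma attP : v \in U /\ e y v.
Proof.
rewrite /v /att; case: pickP => [w /andP[] //|no].
by case/bdP: yU => _ [w wU ew]; move: (no w); rewrite wU ew.
Qed.
Let vU := attP.1.
Let yv := attP.2.
Let yNU := bd_notin yU.

Lemma att_eq u : u \in U -> e y u = (u == v).
Proof.
move=> uU; apply/idP/eqP => [yu|->]; last exact: yv.
exact: (bd_uniq cU yNU).
Qed.

(** If [y] were nearer to [w] than [v] is, it would be the step from [v] towards [w] and so belong
    to [U]. *)
Lemma dist_att w : w \in U -> d y w = (d v w).+1.
Proof.
move=> wU; rewrite ![d _ w]distC; have [//|dd] := dist_edge w yv.
have vw : v != w by rewrite -(dist_eq0 T) distC dd.
move/cvxP: cU => /(_ w v wU vU vw); rewrite (@stepE w v y) ?(negPf yNU) //.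
by rewrite edge_sym.
Qed.

Lemma cvx_ext : cvx (y |: U).
Proof.
have neqy w : w \in U -> w != y by apply: contraTneq => ->.
apply/cvxP => w u; rewrite !inE => /orP[/eqP ->|wU] /orP[/eqP ->|uU].
- by rewrite eqxx.
- move=> uy; have [->|uv] := eqVneq u v.
    by rewrite step_self ?eqxx // edge_sym.
  have [e1 d1] := stepP uv; move/cvxP: cU => /(_ v u vU uU uv) sU.
  by rewrite (@stepE y u (step v u)) ?sU ?orbT // !dist_att // d1.
- move=> _; rewrite (@stepE w y v) ?vU ?orbT //.
  by rewrite distC dist_att // distC.
- by move=> uw; move/cvxP: cU => /(_ w u wU uU uw) ->; rewrite orbT.
Qed.

Lemma nbr_ext_y : nbr (y |: U) y = [set v].
Proof.
apply/setP => u; rewrite !inE; have [->|uy] /= := eqVneq u y.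
  by rewrite edge_irr; apply/esym/negP => /eqP yv'; move: vU yNU; rewrite -yv' => ->.
have [uU|uU] /= := boolP (u \in U); first by rewrite att_eq.
by apply/esym/negP => /eqP uv; move: uU; rewrite uv vU.
Qed.

Lemma deg_ext_y : deg (y |: U) y = 1.
Proof. by rewrite /deg nbr_ext_y cards1. Qed.

Lemma deg_ext u : u \in U -> deg (y |: U) u = deg U u + (u == v).
Proof.
move=> uU; rewrite /deg; have [uv|uv] := eqVneq u v.
  have -> : nbr (y |: U) u = y |: nbr U u.
    apply/setP => w; rewrite !inE; have [-> /=|//] := eqVneq w y.
    by rewrite uv edge_sym yv.
  by rewrite cardsU1 !inE (negPf yNU) addnC.
rewrite addn0; congr #|pred_of_set _|; apply/setP => w; rewrite !inE.
have [-> /=|//] := eqVneq w y.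
by rewrite (negPf yNU) edge_sym att_eq // (negPf uv).
Qed.

Lemma ext_leaf : y \in leaves (y |: U).
Proof. by rewrite !inE eqxx deg_ext_y. Qed.

Lemma ext_card : #|y |: U| = #|U|.+1.
Proof. by rewrite cardsU1 yNU. Qed.

Lemma extK : (y |: U) :\ y = U.
Proof. by rewrite setU1K. Qed.

Lemma out_ext u : u \in U -> out U u = out (y |: U) u + (u == v).
Proof.
move=> uU; rewrite /out; have [uv|uv] := eqVneq u v.
  have -> : nbr (~: U) u = y |: nbr (~: (y |: U)) u.
    apply/setP => w; rewrite !inE; have [-> /=|//] := eqVneq w y.
    by rewrite uv edge_sym yv yNU.
  by rewrite cardsU1 !inE eqxx /= addnC.
rewrite addn0; congr #|pred_of_set _|; apply/setP => w; rewrite !inE.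
have [-> /=|//] := eqVneq w y.
by rewrite yNU edge_sym att_eq // (negPf uv).
Qed.

Lemma bd_ext : bd (y |: U) = (bd U :\ y) :|: nbr (~: (y |: U)) y.
Proof.
apply/setP => w; apply/bdP/idP => [[]|].
  rewrite !inE negb_or => /andP[wy wU] [u].
  rewrite wy wU /= => /setU1P[->|uU] ewu; first by rewrite edge_sym ewu orbT.
  by apply/orP; left; apply/exists_inP; exists u.
rewrite !inE => /orP[/and3P[wy wU /exists_inP[u uU eu]]|].
  by rewrite (negPf wy) wU; split=> //; exists u; rewrite // inE uU orbT.
rewrite negb_or => /andP[/andP[wy wU] ew]; rewrite (negPf wy) (negPf wU); split => //.
by exists y; rewrite ?setU11 // edge_sym.
Qed.

(** A common vertex would have two neighbours in the convex set [y |: U]: [y] and one in [U]. *)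
Lemma bd_nbr_disj : [disjoint bd U & nbr (~: (y |: U)) y].
Proof.
apply/pred0Pn => -[w /= /andP[/bdP[wU [u uU wu]]]].
rewrite !inE negb_or => /andP[/andP[wy _] yw].
have vy : v != y by apply: contraNneq yNU => <-.
have [uv|uv] := eqVneq u v.
  have : d v w = 1 by rewrite distC -uv edge_dist.
  have := dist_edge v yw; rewrite distC (edge_dist yv).
  by move=> + h; rewrite h => -[] .
have e1 := dist_att uU; have := edge2_dist (y := w) wu; rewrite edge_sym in yw.
move=> /(_ y yw); have uy : u != y by apply: contraNneq yNU => <-.
move=> /(_ uy); rewrite distC e1 => -[] /eqP.
rewrite -(edgeE T) edge_sym => euv.
have /= wNU : w \in bd (y |: U).
  by apply/bdP; split; [rewrite !inE negb_or wy wU | exists y; rewrite ?setU11].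
have := bd_uniq cvx_ext (bd_notin wNU) _ _ wu yw.
rewrite setU11 inE uU orbT => /(_ isT isT) /eqP; by rewrite (negPf uy).
Qed.

(** The new vertex leaves the boundary and its outer neighbours join it. In particular an extension
    shrinks the boundary by at most one. *)
Lemma card_bd_ext : #|bd (y |: U)|.+1 = #|bd U| + out (y |: U) y.
Proof.
rewrite bd_ext cardsU.
have -> : (bd U :\ y) :&: nbr (~: (y |: U)) y = set0.
  apply/eqP; rewrite -subset0; apply/subsetP => w; rewrite inE => /andP[].
  rewrite 2!inE => /andP[_ wb] wn.
  by have := disjointFr bd_nbr_disj wb; rewrite wn.
rewrite cards0 subn0 [#|bd U|](cardsD1 y) yU /out; lia.
Qed.

End Ext.

Lemma nbr1_uniq X x u w : #|nbr X x| = 1 -> u \in X -> w \in X ->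
  e x u -> e x w -> u = w.
Proof.
move=> /eqP/cards1P[a ha] uX wX xu xw.
have : u \in nbr X x by rewrite inE uX.
have : w \in nbr X x by rewrite inE wX.
by rewrite ha !inE => /eqP -> /eqP ->.
Qed.

Section Rem.
Variables (X : {set V}) (x : V).
Hypotheses (cX : cvx X) (xL : x \in leaves X).

Lemma leaf_in : x \in X. Proof. by move: xL; rewrite inE => /andP[]. Qed.

(** A leaf is never strictly between two vertices of [X]: the vertices before and after it on the
    path would both be its only neighbour. *)
Lemma cvx_rem : cvx (X :\ x).
Proof.
move: xL; rewrite inE => /andP[xX /eqP d1].
apply/cvxP => w u; rewrite !inE => /andP[wx wX] /andP[ux uX] uw.
move/cvxP: (cX) => cX'; rewrite cX' // andbT.
have [e1 d2] := stepP uw; apply/eqP => sx; rewrite sx in e1 d2.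
have xw : x != w by rewrite eq_sym.
have [e3 d3] := stepP xw.
have := nbr1_uniq d1 uX (cX' w x wX xX xw) _ e3; rewrite edge_sym => /(_ e1) us.
by move: d3; rewrite -us d2; lia.
Qed.

Lemma rem_bd : x \in bd (X :\ x).
Proof.
move: xL; rewrite inE => /andP[xX /eqP/eqP/cards1P[a ha]].
have : a \in nbr X x by rewrite ha set11.
rewrite inE => /andP[aX xa]; apply/bdP; rewrite !inE eqxx; split=> //.
by exists a; rewrite // !inE aX andbT eq_sym edge_neq.
Qed.

Lemma remK : x |: (X :\ x) = X.
Proof. by rewrite setD1K // leaf_in. Qed.

Lemma rem_card : #|X| = #|X :\ x|.+1.
Proof. by rewrite (cardsD1 x) leaf_in. Qed.

End Rem.
End TreeMetric.

Section Subtrees.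
Variables (V : finType) (T : tree_metric V).
Local Notation e := (edge T).
Local Notation d := (dist T).
Local Notation cvx := (cvx T).
Local Notation bd := (bd T).
Local Notation deg := (deg T).
Local Notation leaves := (leaves T).
Local Notation att := (att T).
Local Notation out := (out T).
Local Notation step := (step T).
Local Notation nbr := (nbr T).

Implicit Types (X Y U H : {set V}) (u v w x y z : V).

Lemma dist_triangle u v w : d u w <= d u v + d v w.
Proof.
have [n] := ubnP (d v w); elim: n => // n IH in w *.
have [->|wv] := eqVneq w v; first by rewrite leq_addr.
have [e1 d1] := stepP T wv; have [d2|d2] := dist_edge u e1; rewrite d1 => ln.
  by have := IH _ ln; lia.
by have := IH _ ln; lia.
Qed.

Lemma deg_pos X u : cvx X -> u \in X -> 1 < #|X| -> 0 < deg X u.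
Proof.
move=> /cvxP cX uX; rewrite (cardsD1 u) uX /= ltnS => /card_gt0P[w].
rewrite !inE => /andP[wu wX]; apply/card_gt0P; exists (step w u).
have uw : u != w by rewrite eq_sym.
by have [e1 _] := stepP T uw; rewrite inE cX.
Qed.

Lemma leavesP X x : reflect (x \in X /\ deg X x = 1) (x \in leaves X).
Proof. by rewrite inE; apply: (iffP andP) => -[? /eqP]. Qed.

Section Leaf.
Variables (X : {set V}) (x : V).
Hypothesis xL : x \in leaves X.

Lemma leaf_att : att X x \in X /\ e x (att X x).
Proof.
rewrite /att; case: pickP => [w /andP[] //|no].
case/leavesP: xL => _ /eqP/cards1P[a ha].
have : a \in nbr X x by rewrite ha set11.
by rewrite inE => /andP[aX xa]; move: (no a); rewrite aX xa.
Qed.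

Lemma leaf_att_eq u : u \in X -> e x u = (u == att X x).
Proof.
have [aX xa] := leaf_att; move=> uX; apply/idP/eqP => [xu|-> //].
by case/leavesP: xL => _ d1; apply: nbr1_uniq d1 uX aX xu xa.
Qed.

Lemma att_rem : att (X :\ x) x = att X x.
Proof.
have [] := attP (rem_bd xL); rewrite !inE => /andP[_ aX].
by rewrite leaf_att_eq // => /eqP.
Qed.

Lemma att_neq : att X x != x.
Proof. by have [_ /edge_neq] := leaf_att; rewrite eq_sym. Qed.

Lemma att_in_rem : att X x \in X :\ x.
Proof. by rewrite !inE att_neq leaf_att.1. Qed.

Lemma deg_rem u : cvx X -> u \in X :\ x -> deg X u = deg (X :\ x) u + (u == att X x).
Proof.
move=> cX uX; rewrite -{1}(remK xL) deg_ext ?att_rem //.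
  exact: cvx_rem.
exact: rem_bd.
Qed.

Lemma out_rem u : cvx X -> u \in X :\ x -> out (X :\ x) u = out X u + (u == att X x).
Proof.
by move=> cX uX; rewrite (out_ext (cvx_rem cX xL) (rem_bd xL)) // (remK xL) att_rem.
Qed.

Lemma card_bd_rem : cvx X -> #|bd X|.+1 = #|bd (X :\ x)| + out X x.
Proof.
by move=> cX; rewrite -{1 3}(remK xL) (card_bd_ext (cvx_rem cX xL) (rem_bd xL)).
Qed.

Lemma leaf_att_notleaf : cvx X -> 2 < #|X| -> att X x \notin leaves X.
Proof.
move=> cX X3; have [aX xa] := leaf_att; have cR := cvx_rem cX xL.
rewrite inE aX /= deg_rem ?att_in_rem // eqxx addn1 eqSS -lt0n deg_pos //.
  exact: att_in_rem.
by rewrite -ltnS -(rem_card xL).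
Qed.

End Leaf.

Section Ext.
Variables (U : {set V}) (y : V).
Hypotheses (cU : cvx U) (yU : y \in bd U) (U2 : 1 < #|U|).
Let v := att U y.

Lemma leaves_ext : leaves (y |: U) = y |: (leaves U :\ v).
Proof.
have yNU := bd_notin yU; apply/setP => u; rewrite !inE.
have [->|uy] /= := eqVneq u y; first by rewrite deg_ext_y.
have [uU|uU] /= := boolP (u \in U); last by rewrite andbF.
rewrite deg_ext // -/v; have [->|_] /= := eqVneq u v; last by rewrite addn0.
have [vU _] := attP yU; have := deg_pos cU vU U2; rewrite -/v.
by case: (deg U v) => // n _; rewrite addn1.
Qed.

Lemma card_leaves_ext : #|leaves (y |: U)| + (v \in leaves U) = #|leaves U|.+1.
Proof.
rewrite leaves_ext cardsU1 [#|leaves U|](cardsD1 v) /=.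
have -> : y \notin leaves U :\ v; last by lia.
by apply: contra (bd_notin yU); rewrite !inE => /and3P[].
Qed.

Lemma att_ext : att (y |: U) y = v.
Proof. by rewrite -(att_rem (ext_leaf cU yU)) (extK yU). Qed.

End Ext.

Definition mv X v := #|[set x in leaves X | e x v]|.

Lemma mvE X v : v \in X -> mv X v = #|[set x in leaves X | att X x == v]|.
Proof.
move=> vX; congr #|pred_of_set _|; apply/setP => x; rewrite 2!in_set.
by apply: andb_id2l => xL; rewrite (leaf_att_eq xL) 1?eq_sym.
Qed.

Lemma sum_mv X (P : {set V}) : P \subset X ->
  \sum_(v in P) mv X v = #|[set x in leaves X | att X x \in P]|.
Proof.
move=> PX; rewrite -sum1_card [RHS](partition_big (att X) (mem P)) /=; last first.
  by move=> x; rewrite in_set => /andP[].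
apply: eq_bigr => v vP; rewrite mvE ?(subsetP PX) // -sum1_card.
apply: eq_bigl => x; rewrite 2!in_set -andbA; congr (_ && _).
by have [->|] := eqVneq (att X x) v; rewrite ?vP ?andbF.
Qed.

Lemma outE X v : cvx X -> v \in X -> out X v = #|[set y in bd X | att X y == v]|.
Proof.
move=> cX vX; congr #|pred_of_set _|; apply/setP => y.
rewrite in_nbr in_setC in_set edge_sym; apply/andP/andP => [[yX yv]|[yB /eqP av]].
  have yB : y \in bd X by apply/bdP; split=> //; exists v.
  by split=> //; rewrite eq_sym -(att_eq cX yB).
by split; [exact: bd_notin yB | rewrite (att_eq cX yB) ?av].
Qed.

Lemma sum_out X (P : {set V}) : cvx X -> P \subset X ->
  \sum_(v in P) out X v = #|[set y in bd X | att X y \in P]|.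
Proof.
move=> cX PX; rewrite -sum1_card [RHS](partition_big (att X) (mem P)) /=; last first.
  by move=> x; rewrite in_set => /andP[].
apply: eq_bigr => v vP; rewrite outE ?(subsetP PX) // -sum1_card.
apply: eq_bigl => x; rewrite 2!in_set -andbA; congr (_ && _).
by have [->|] := eqVneq (att X x) v; rewrite ?vP ?andbF.
Qed.

(** Among the vertices of [X] behind [v] as seen from [w], one farthest from [w] has no neighbour in
    [X] except the one towards [w]. *)
Lemma leaf_beyond X w v : cvx X -> w \in X -> v \in X -> v != w ->
  exists2 x, x \in leaves X & d w x = d w v + d v x.
Proof.
move=> cX wX vX vw.
have [|x /andP[xX /eqP dx] mx] :=
  @arg_maxnP _ v (fun x => (x \in X) && (d w x == d w v + d v x)) (fun x => d w x).
  by rewrite vX distxx addn0 eqxx.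
exists x => //; have xw : x != w.
  rewrite -(dist_eq0 T) distC dx addn_eq0 negb_and.
  by rewrite distC dist_eq0 vw.
have [e1 d1] := stepP T xw; have sX := cvxP _ _ cX w x wX xX xw.
apply/leavesP; split=> //; apply/eqP/cards1P; exists (step w x).
apply/setP => z; rewrite in_nbr in_set1; apply/andP/eqP => [[zX xz]|->//].
have [dz|dz] := dist_edge w xz; first by rewrite -(stepE xz dz).
have /mx : (z \in X) && (d w z == d w v + d v z).
  rewrite zX /=; have := dist_triangle w v z; have := dist_triangle v x z.
  by rewrite (edge_dist xz); lia.
by rewrite /= dz ltnn.
Qed.

Lemma leaf_exists X : cvx X -> 1 < #|X| -> exists x, x \in leaves X.
Proof.
move=> cX /card_gt1P[w [v [wX vX wv]]].
by have [|x xL _] := leaf_beyond cX wX vX; [rewrite eq_sym|exists x].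
Qed.

Lemma cvx_ind (P : {set V} -> Prop) :
  (forall x, P [set x]) ->
  (forall U y, cvx U -> y \in bd U -> 0 < #|U| -> P U -> P (y |: U)) ->
  forall X, cvx X -> 0 < #|X| -> P X.
Proof.
move=> P1 PS X; have [n] := ubnP #|X|; elim: n => // n IH in X *.
move=> Xn cX X0; have [|X1] := leqP #|X| 1.
  move=> X1; have /cards1P[x ->] : #|X| == 1 by rewrite eqn_leq X1.
  exact: P1.
have [x xL] := leaf_exists cX X1; rewrite -(remK xL).
have cR := rem_card xL; have cv := cvx_rem cX xL.
by apply: PS => //; [exact: rem_bd|lia|apply: IH => //; lia].
Qed.

Lemma deg_set1 x : deg [set x] x = 0.
Proof.
apply/eqP; rewrite cards_eq0; apply/eqP/setP => u; rewrite !inE.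
by have [->|] := eqVneq u x; rewrite ?edge_irr.
Qed.

(** Within [U], only the degree of the attachment vertex changes. A general [F] serves both the
    handshake formula and the squared degrees. *)
Lemma big_ext_deg U y (F : nat -> nat) : cvx U -> y \in bd U ->
  \sum_(u in y |: U) F (deg (y |: U) u) + F (deg U (att U y)) =
  F 1 + \sum_(u in U) F (deg U u) + F (deg U (att U y)).+1.
Proof.
move=> cU yU; have yNU := bd_notin yU; have [vU _] := attP yU.
rewrite big_setU1 //= deg_ext_y // (bigD1 (att U y)) //=.
rewrite [X in _ = _ + X + _](bigD1 (att U y)) //= deg_ext // eqxx addn1.
rewrite (eq_bigr (fun u => F (deg U u))); first by lia.
by move=> u /andP[uU /negPf ne]; rewrite deg_ext // ne addn0.
Qed.

Lemma handshake X : cvx X -> 0 < #|X| -> \sum_(u in X) deg X u + 2 = 2 * #|X|.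
Proof.
move: X; apply: cvx_ind => [x|U y cU yU U0 IH].
  by rewrite big_set1 deg_set1 cards1.
have := big_ext_deg (fun n => n) cU yU; rewrite (ext_card yU); lia.
Qed.

Definition qs X := \sum_(u in X) deg X u ^ 2.

(** Hence [qs (y |: U)] reveals the degree of the vertex to which [y] was attached. *)
Lemma qs_ext U y : cvx U -> y \in bd U ->
  qs (y |: U) = qs U + 2 * deg U (att U y) + 2.
Proof. move=> cU yU; have := big_ext_deg (fun n => n ^ 2) cU yU; rewrite /qs; nia. Qed.

Definition ds X v := \sum_(u in X) d v u.
(* Twice the Wiener index. *)
Definition wn X := \sum_(u in X) ds X u.

Lemma ds_ext U y v : y \notin U -> ds (y |: U) v = d v y + ds U v.
Proof. by move=> yU; rewrite /ds big_setU1. Qed.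

Lemma wn_ext U y : y \notin U -> wn (y |: U) = wn U + 2 * ds U y.
Proof.
move=> yU; rewrite /wn big_setU1 //= ds_ext // distxx add0n.
under eq_bigr => u _ do rewrite ds_ext // distC.
by rewrite big_split /=; rewrite /ds; lia.
Qed.

(** Together with [wn_ext], this lets the Wiener index of [y |: U] reveal the distance sum of the
    attachment vertex. *)
Lemma ds_att U y : cvx U -> y \in bd U -> ds U y = ds U (att U y) + #|U|.
Proof.
move=> cU yU; rewrite /ds -sum1_card -big_split /=.
by apply: eq_bigr => u uU; rewrite (dist_att cU yU uU) addn1.
Qed.

Lemma iter_between z0 v x : d z0 x = d z0 v + d v x -> iter (d v x) (step z0) x = v.
Proof.
have [n] := ubnP (d v x); elim: n => // n IH in x *.
rewrite ltnS => dn h; have [->|xv] := eqVneq x v; first by rewrite distxx.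
have [e1 d1] := stepP T xv; rewrite d1 iterSr.
have s1 : step z0 x = step v x.
  apply: stepE => //; have := dist_triangle z0 v (step v x).
  by have [|] := dist_edge z0 e1; lia.
rewrite s1; apply: IH; first by rewrite -d1 in dn *; lia.
have [e2 d2] : e x (step z0 x) /\ d z0 x = (d z0 (step z0 x)).+1.
  by apply: stepP; rewrite -(dist_eq0 T) distC; move: h d1; lia.
by rewrite s1 in d2; lia.
Qed.

Section Convex.
Variables (U : {set V}).
Hypotheses (cU : cvx U).

(** No vertex is nearer to both [a] and [c] than to [b], since its step at [b] is unique. So every
    term is convex along [a], [b], [c], and the term of [b] itself gives the extra 2. *)
Lemma ds_convex b a c : a \in U -> b \in U -> c \in U -> e b a -> e b c -> a != c ->
  ds U b + ds U b + 2 <= ds U a + ds U c.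
Proof.
move=> aU bU cinU ba bc ac; rewrite /ds (bigD1 b) //= distxx.
rewrite [X in _ <= X + _](bigD1 b) //= [X in _ <= _ + X](bigD1 b) //=.
rewrite ![d _ b]distC (edge_dist ba) (edge_dist bc).
set P := fun i => _; rewrite !add0n -[X in X + 2]big_split /=.
rewrite addnACA -big_split /= addnC leq_add2l.
apply: leq_sum => u _; rewrite ![d _ u]distC.
have [d1|d1] := dist_edge u ba; have [d2|d2] := dist_edge u bc; try lia.
by move/eqP: ac; case; rewrite -(stepE ba d1) -(stepE bc d2).
Qed.

Variable z0 : V.
Hypotheses (zU : z0 \in U) (zmin : forall u, u \in U -> ds U z0 <= ds U u).

(** Induction outwards from the minimiser [z0]: strict convexity turns a weak increase along one
    edge into a strict one along the next. *)
Lemma ds_incr u c : u \in U -> c \in U -> u != z0 -> e u c ->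
  d z0 c = (d z0 u).+1 -> ds U u < ds U c.
Proof.
have [n] := ubnP (d z0 u); elim: n => // n IH in u c *.
rewrite ltnS => dn uU cinU uz uc dc; have [e1 d1] := stepP T uz.
have sU := cvxP _ _ cU z0 u zU uU uz.
have le1 : ds U (step z0 u) <= ds U u.
  have [->|sz] := eqVneq (step z0 u) z0; first exact: zmin.
  by apply/ltnW/IH => //; [rewrite -d1|rewrite edge_sym].
have sc : step z0 u != c by apply/eqP => h; move: d1; rewrite h; lia.
by have := ds_convex sU uU cinU e1 uc sc; lia.
Qed.

Lemma ds_iter x j : x \in U -> iter j (step z0) x != z0 ->
  iter j (step z0) x \in U /\ ds U (iter j (step z0) x) + j <= ds U x.
Proof.
move=> xU; elim: j => [|j IH] /=; first by rewrite addn0.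
set y := iter j _ x in IH *.
have [->|yz] := eqVneq y z0.
  rewrite /step; case: pickP => [v /andP[_ /eqP]|_ /=]; last by rewrite eqxx.
  by rewrite distxx.
have [yU le] := IH yz; move=> sz; have [e1 d1] := stepP T yz.
have sU := cvxP _ _ cU z0 y zU yU yz; split=> //.
have := @ds_incr (step z0 y) y sU yU sz; rewrite edge_sym => /(_ e1 d1); lia.
Qed.

End Convex.

(** Send each vertex of the level set other than the minimiser [z0] to a leaf behind it. Two
    vertices with the same leaf lie on one path from [z0], along which [ds U] strictly increases; so
    the map is injective. The extra one is for [z0]. *)
Lemma card_ds_level U c : cvx U -> 1 < #|U| ->
  #|[set v in U | ds U v == c]| <= #|leaves U|.+1.
Proof.
move=> cU U2; have /card_gt0P[u0 u0U] : 0 < #|U| by apply: ltnW.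
have [z0 zU zmin] := @arg_minnP _ u0 (mem U) (ds U) u0U.
set G := [set v in U | _].
rewrite (cardsD1 z0) -add1n leq_add ?leq_b1 //.
pose f v := odflt v [pick x in leaves U | d z0 x == d z0 v + d v x].
have fP v : v \in G :\ z0 -> f v \in leaves U /\ d z0 (f v) = d z0 v + d v (f v).
  move=> /setD1P[vz /setIdP[vU _]]; rewrite /f; case: pickP => [x /andP[x1 /eqP x2]|no] /=.
    by split.
  by have [x xL dx] := leaf_beyond cU zU vU vz; move: (no x); rewrite xL dx eqxx.
(* The walk from [v'] towards [z0] reaches [v], and each of its steps lowers [ds U]; equal values
   leave no room for a step. *)
have anti x v v' : v \in G :\ z0 -> v' \in G :\ z0 ->
    iter (d v x) (step z0) x = v -> iter (d v' x) (step z0) x = v' ->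
    d v' x <= d v x -> v = v'.
  rewrite !inE => /and3P[vz _ /eqP cv] /and3P[_ v'U /eqP cv'] i1 i2 le.
  have iv : iter (d v x - d v' x) (step z0) v' = v.
    by move: i1; rewrite -{1}(subnK le) iterD i2.
  have := @ds_iter _ cU _ zU zmin v' (d v x - d v' x) v'U.
  rewrite iv => /(_ vz)[_]; rewrite cv cv' => h.
  by rewrite -iv (_ : _ - _ = 0) //; lia.
have inj : {in G :\ z0 &, injective f}.
  move=> v v' vG vG' ff; have [_ d1] := fP _ vG; have [_ d2] := fP _ vG'.
  rewrite -ff in d2; have i1 := iter_between d1; have i2 := iter_between d2.
  have [le|/ltnW le] := leqP (d v' (f v)) (d v (f v)); first exact: anti i1 i2 le.
  exact/esym/(anti _ _ _ vG' vG i2 i1 le).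
rewrite -(card_in_imset inj); apply: subset_leq_card.
by apply/subsetP => _ /imsetP[v vG ->]; have [] := fP _ vG.
Qed.
End Subtrees.

(** * Isomorphism invariants *)

Section Invariants.
Variables (V : finType) (T : tree_metric V).
Local Notation e := (edge T).
Local Notation d := (dist T).
Local Notation cvx := (cvx T).
Local Notation bd := (bd T).
Local Notation deg := (deg T).
Local Notation leaves := (leaves T).
Local Notation att := (att T).
Local Notation out := (out T).
Local Notation step := (step T).
Local Notation nbr := (nbr T).
Local Notation mv := (mv T).
Local Notation qs := (qs T).
Local Notation wn := (wn T).
Local Notation ds := (ds T).

Implicit Types (X Y U H : {set V}) (u v w x y z : V).

Definition nonstar X := ~~ [exists v in X, [forall u in X, (u != v) ==> e v u]].

Lemma nonstar_far X v : nonstar X -> v \in X -> exists2 u, u \in X & 1 < d v u.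
Proof.
rewrite /nonstar negb_exists_in => /forall_inP h /h.
rewrite negb_forall_in => /exists_inP[u uX]; rewrite negb_imply => /andP[uv nuv].
exists u => //; rewrite ltn_neqAle eq_sym -(edgeE T) nuv lt0n.
by rewrite (dist_eq0 T) eq_sym.
Qed.

Lemma far_neq v u : 1 < d v u -> u != v.
Proof. by apply: contraTneq => ->; rewrite distxx. Qed.

Lemma nonstar_leaf X v : cvx X -> nonstar X -> v \in X ->
  exists2 x, x \in leaves X & ~~ e x v.
Proof.
move=> cX nX vX; have [u uX duv] := nonstar_far nX vX.
have [x xL dx] := leaf_beyond cX vX uX (far_neq duv).
by exists x; rewrite // edgeE distC dx; lia.
Qed.

(** The first vertex on the path from [v] to a vertex at distance at least 2 has two neighbours in
    [X]. *)
Lemma nonstar_inner X v : cvx X -> nonstar X -> v \in X ->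
  exists a, [/\ a \in X, e v a & a \notin leaves X].
Proof.
move=> cX nX vX; have [u uX duv] := nonstar_far nX vX.
have vu : v != u by rewrite eq_sym far_neq.
have [e1 d1] := stepP T vu; have aX := cvxP _ _ cX u v uX vX vu.
exists (step u v); split=> //; apply/negP => aL.
have au : step u v != u.
  by apply: contraTneq duv => h; move: d1; rewrite h distxx distC => ->.
have [e2 d2] := stepP T au; have bX := cvxP _ _ cX u _ uX aX au.
have : v = step u (step u v).
  have /leavesP[_ dg] := aL.
  by apply: (nbr1_uniq dg) => //; rewrite edge_sym.
by move=> h; move: d1; rewrite d2 -h; lia.
Qed.

Lemma nonstar_card X : cvx X -> nonstar X -> 0 < #|X| -> 3 < #|X|.
Proof.
move=> cX nX /card_gt0P[v vX]; have [x xL _] := nonstar_leaf cX nX vX.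
have [pX xp] := leaf_att xL; set p := att X x in pX xp.
have [a [aX pa aL]] := nonstar_inner cX nX pX.
have [u uX du] := nonstar_far nX pX; have xX := leaf_in xL.
have ax : a != x by apply: contraNneq aL => ->.
have px : p != x by rewrite eq_sym (edge_neq xp).
have ux : u != x by apply: contraTneq du => ->; rewrite distC (edge_dist xp).
have ua : u != a by apply: contraTneq du => ->; rewrite (edge_dist pa).
have up := far_neq du; have ap : a != p by rewrite eq_sym (edge_neq pa).
have /subset_leq_card : u |: (a |: (p |: [set x])) \subset X.
  by rewrite !subUset !sub1set uX aX pX xX.
by rewrite !cardsU1 cards1 !inE !negb_or ua up ux ap ax px.
Qed.

Lemma mv_lt_deg X v : cvx X -> nonstar X -> v \in X -> mv X v < deg X v.
Proof.
move=> cX nX vX; have [a [aX va aL]] := nonstar_inner cX nX vX.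
apply: proper_card; apply/properP; split.
  apply/subsetP => x /setIdP[xL xv].
  by rewrite in_nbr (leaf_in xL) edge_sym.
by exists a; [rewrite in_nbr aX | rewrite inE (negPf aL)].
Qed.

Lemma mv_lt_leaves X v : cvx X -> nonstar X -> v \in X -> mv X v < #|leaves X|.
Proof.
move=> cX nX vX; have [x xL xv] := nonstar_leaf cX nX vX.
apply: proper_card; apply/properP; split; first by apply/subsetP => y /setIdP[].
by exists x; rewrite // inE (negPf xv) andbF.
Qed.

(** Counting leaves once more makes every term at least 2 as soon as [1 < #|X|], and the total
    excess over 2 is [#|leaves X| - 2]. *)
Lemma sum_deg_leaf X : cvx X -> 0 < #|X| ->
  \sum_(w in X) (deg X w + (w \in leaves X)) + 2 = 2 * #|X| + #|leaves X|.
Proof.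
move=> cX X0; rewrite big_split /= -(handshake cX X0) -!addnA; congr (_ + _).
rewrite addnC; congr (_ + _); rewrite -sum1_card big_mkcond [RHS]big_mkcond.
apply: eq_bigr => w _; case: ifP; rewrite !inE; last by move=> ->.
by move=> -> /=; case: eqP.
Qed.

Lemma deg_leaf_ge2 X w : cvx X -> 1 < #|X| -> w \in X ->
  2 <= deg X w + (w \in leaves X).
Proof.
by move=> cX X1 wX; have := deg_pos cX wX X1; rewrite inE wX /=; case: eqP; lia.
Qed.

(** The excesses of [u] and [v] over 2 are part of the total excess [#|leaves X| - 2]. *)
Lemma deg_pair X u v : cvx X -> u \in X -> v \in X -> u != v ->
  deg X u + deg X v <= #|leaves X| + 2.
Proof.
move=> cX uX vX uv.
have X1 : 1 < #|X| by apply/card_gt1P; exists u, v.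
have := sum_deg_leaf cX (ltnW X1); rewrite (bigD1 u) //= (bigD1 v) /=; last first.
  by rewrite vX eq_sym.
have : 2 * (#|X| - 2) <=
   \sum_(i | (i \in X) && (i != u) && (i != v)) (deg X i + (i \in leaves X)).
  have -> : #|X| - 2 = \sum_(i | (i \in X) && (i != u) && (i != v)) 1.
    have := sum1_card (mem X); rewrite (bigD1 u) //= (bigD1 v) /=; last first.
      by rewrite vX eq_sym.
    by move=> <-; rewrite addnA addKn.
  rewrite big_distrr /=; apply: leq_sum => i /andP[/andP[iX _] _].
  by rewrite muln1 deg_leaf_ge2.
set s1 := \sum_(i | _) _; lia.
Qed.

Definition ksets k := [set X | cvx X && (#|X| == k)].

Lemma ksetsP k X : reflect (cvx X /\ #|X| = k) (X \in ksets k).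
Proof. by rewrite inE; apply: (iffP andP) => -[? /eqP]. Qed.

Lemma ext_ksets k U y : U \in ksets k -> y \in bd U -> y |: U \in ksets k.+1.
Proof.
move=> /ksetsP[cU Uk] yU; apply/ksetsP; split; first exact: cvx_ext.
by rewrite (ext_card yU) Uk.
Qed.

Lemma rem_ksets k H z : H \in ksets k.+1 -> z \in leaves H -> H :\ z \in ksets k.
Proof.
move=> /ksetsP[cH Hk] zH; apply/ksetsP; split; first exact: cvx_rem.
by apply/eqP; rewrite -eqSS -(rem_card zH) Hk.
Qed.

Section EdgeSum.
Variables (R : Type) (idx : R) (op : Monoid.com_law idx) (k : nat).

(** A subtree with a chosen leaf is the same as a subtree with one vertex less and a chosen boundary
    vertex. The double counts of exchanges below rest on this bijection. *)
Lemma edge_sum (F : {set V} -> V -> R) :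
  \big[op/idx]_(H in ksets k.+1) \big[op/idx]_(z in leaves H) F (H :\ z) z =
  \big[op/idx]_(U in ksets k) \big[op/idx]_(y in bd U) F U y.
Proof.
rewrite !pair_big_dep /= [RHS](reindex_onto (fun p => (p.1 :\ p.2, p.2))
  (fun p => (p.2 |: p.1, p.2))) /=; last first.
  by move=> [U y] /= /andP[_ yU]; rewrite (extK yU).
apply: eq_bigl => -[H z] /=; apply/andP/andP => [[Hk zH]|[/andP[Uk zU]]].
  by rewrite rem_ksets // rem_bd // (remK zH).
move=> /eqP[HH]; have /ksetsP[cU _] := Uk.
by rewrite -HH ext_ksets // ext_leaf.
Qed.

(* Removing [x] and adding [w] is undone by removing [w] and adding [x]. *)
Lemma swap_sum (F : {set V} -> V -> V -> R) :
  \big[op/idx]_(H in ksets k.+1) \big[op/idx]_(x in leaves H)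
     \big[op/idx]_(w in bd (H :\ x)) F (H :\ x) x w =
  \big[op/idx]_(H in ksets k.+1) \big[op/idx]_(w in leaves H)
     \big[op/idx]_(x in bd (H :\ w)) F (H :\ w) x w.
Proof.
rewrite (edge_sum (fun U x => \big[op/idx]_(w in bd U) F U x w)).
rewrite (edge_sum (fun U w => \big[op/idx]_(x in bd U) F U x w)).
by apply: eq_bigr => U _; rewrite exchange_big.
Qed.
End EdgeSum.

Definition iso X X' := exists h : V -> V,
  [/\ {in X &, injective h}, h @: X = X' & {in X &, forall u v, e (h u) (h v) = e u v}].

Lemma dist_hom X (h : V -> V) : cvx X ->
  {in X &, forall u v, e u v -> e (h u) (h v)} ->
  {in X &, forall u v, d (h u) (h v) <= d u v}.
Proof.
move=> cX hh u v uX vX; have [n] := ubnP (d u v); elim: n => // n IH in v vX *.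
rewrite ltnS => dn; have [->|vu] := eqVneq v u; first by rewrite !distxx.
have [e1 d1] := stepP T vu; have sX := cvxP _ _ cX u v uX vX vu.
have := dist_triangle T (h u) (h (step u v)) (h v).
rewrite d1 in dn *; have := IH _ sX dn.
by have := edge_dist (hh v _ vX sX e1); rewrite distC; lia.
Qed.

(** The invariant that separates the starlike case from the other one. *)
Definition mx X := \max_(v in X) mv X v.

Section Iso.
Variables (X X' : {set V}) (h : V -> V).
Hypotheses (cX : cvx X) (cX' : cvx X') (hi : {in X &, injective h})
  (hX : h @: X = X') (he : {in X &, forall u v, e (h u) (h v) = e u v}).

Lemma iso_mem u : u \in X -> h u \in X'.
Proof. by move=> uX; rewrite -hX imset_f. Qed.

Lemma iso_nbr u : u \in X -> nbr X' (h u) = h @: nbr X u.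
Proof.
move=> uX; apply/setP => w; rewrite in_nbr -hX; apply/andP/imsetP => [[]|].
  by case/imsetP => v vX ->; rewrite he // => uv; exists v; rewrite // in_nbr vX.
by case=> v; rewrite in_nbr => /andP[vX uv] ->; rewrite imset_f // he.
Qed.

Lemma iso_deg u : u \in X -> deg X' (h u) = deg X u.
Proof.
move=> uX; rewrite /deg iso_nbr // card_in_imset // => v w.
by rewrite !in_nbr => /andP[vX _] /andP[wX _]; apply: hi.
Qed.

Lemma iso_leaves : leaves X' = h @: leaves X.
Proof.
apply/setP => w; apply/leavesP/imsetP => [[]|[u /leavesP[uX du] ->]].
  by rewrite -{1}hX => /imsetP[u uX ->]; rewrite iso_deg // => du; exists u => //; apply/leavesP.
by rewrite iso_mem // iso_deg.
Qed.

Lemma leaves_inj : {in leaves X &, injective h}.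
Proof. by move=> u v uL vL; apply: hi; [exact: leaf_in uL|exact: leaf_in vL]. Qed.

Lemma iso_card_leaves : #|leaves X'| = #|leaves X|.
Proof. by rewrite iso_leaves card_in_imset //; apply: leaves_inj. Qed.

Lemma iso_qs : qs X' = qs X.
Proof.
rewrite /qs -hX big_imset //=; apply: eq_bigr => u uX.
by rewrite hX iso_deg.
Qed.

(** A map that preserves edges does not lengthen distances; this applies to [h] and to its inverse
    [g]. *)
Lemma iso_dist : {in X &, forall u v, d (h u) (h v) = d u v}.
Proof.
pose g w := odflt w [pick u in X | h u == w].
have gh u : u \in X -> g (h u) = u.
  move=> uX; rewrite /g; case: pickP => [v /andP[vX /eqP]|/(_ u)] /=.
    exact: hi.
  by rewrite uX eqxx.
move=> u v uX vX; apply/eqP; rewrite eqn_leq (dist_hom cX) //=; last first.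
  by move=> a b aX bX; rewrite he.
rewrite -{1}(gh u uX) -{1}(gh v vX); apply: (dist_hom cX'); try exact: iso_mem.
by move=> a b; rewrite -hX => /imsetP[a' aX ->] /imsetP[b' bX ->]; rewrite !gh // he.
Qed.

Lemma iso_wn : wn X' = wn X.
Proof.
rewrite /wn -{1}hX big_imset //=; apply: eq_bigr => u uX.
rewrite /ds -{1}hX big_imset //=; apply: eq_bigr => v vX.
exact: iso_dist.
Qed.

Lemma iso_mv u : u \in X -> mv X' (h u) = mv X u.
Proof.
move=> uX; rewrite /mv; set A := [set x in leaves X | _].
have -> : [set x in leaves X' | e x (h u)] = h @: A.
  apply/setP => w; apply/setIdP/imsetP => [[]|[x /setIdP[xL xu] ->]].
    rewrite iso_leaves => /imsetP[x xL ->]; rewrite he ?(leaf_in xL) // => xu.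
    by exists x => //; apply/setIdP.
  by rewrite iso_leaves imset_f // he // (leaf_in xL).
rewrite card_in_imset // => v w /setIdP[vL _] /setIdP[wL _]; exact: leaves_inj.
Qed.

Lemma iso_mx : mx X' = mx X.
Proof.
rewrite /mx -{1}hX big_imset //=; apply: eq_bigr => u uX.
exact: iso_mv.
Qed.

End Iso.
End Invariants.

(** * Counting exchanges of a leaf *)

Section Counting.
Variables (V : finType) (T : tree_metric V).
Local Notation e := (edge T).
Local Notation d := (dist T).
Local Notation cvx := (cvx T).
Local Notation bd := (bd T).
Local Notation deg := (deg T).
Local Notation leaves := (leaves T).
Local Notation att := (att T).
Local Notation out := (out T).
Local Notation step := (step T).
Local Notation nbr := (nbr T).
Local Notation mv := (mv T).
Local Notation qs := (qs T).
Local Notation wn := (wn T).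
Local Notation ds := (ds T).
Local Notation mx := (mx T).
Local Notation nonstar := (nonstar T).
Local Notation ksets := (ksets T).

Implicit Types (X Y U H : {set V}) (u v w x y z : V).

Lemma bd_gt0 X : X != set0 -> #|X| < #|V| -> 0 < #|bd X|.
Proof.
move=> /set0Pn[w wX] lt; have [u0 u0X] : exists u, u \notin X.
  apply/existsP; apply: contraTT lt; rewrite negb_exists -leqNgt => /forallP h.
  by apply/subset_leq_card/subsetP => u _; have := h u; rewrite negbK.
have [u uX um] := @arg_minnP _ u0 (fun u => u \notin X) (fun u => d w u) u0X.
have uw : u != w by apply: contraNneq uX => ->.
have [e1 d1] := stepP T uw; apply/card_gt0P; exists u; apply/bdP; split=> //.
exists (step w u) => //; apply/negPn/negP => /um; rewrite d1; lia.
Qed.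

Lemma bd_rem_keep X x w : cvx X -> x \in leaves X -> w \in bd X -> att X w != x ->
  w \in bd (X :\ x) /\ att (X :\ x) w = att X w.
Proof.
move=> cX xL wX ne; have [aX wa] := attP wX.
have aR : att X w \in X :\ x by rewrite !inE ne aX.
have wR : w \in bd (X :\ x).
  apply/bdP; split; last by exists (att X w).
  by rewrite inE negb_and (bd_notin wX) orbT.
split=> //; apply/esym/eqP; rewrite -(att_eq (cvx_rem cX xL) wR) //.
Qed.

Lemma mem_ext U y u : u \in U -> u \in y |: U.
Proof. by move=> uU; rewrite inE uU orbT. Qed.

(** * Good and bad extensions of a subtree with one vertex less *)

Section Family.
Variables (k l q0 w0 m : nat) (SS : {set {set V}}).
Hypotheses (Sk : SS \subset ksets k.+1)
  (Sl : {in SS, forall X, #|leaves X| = l})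
  (Sq : {in SS, forall X, qs X = q0})
  (Sw : {in SS, forall X, wn X = w0})
  (Sm : {in SS, forall X, mx X = m})
  (Sn : {in SS, forall X, nonstar X})
  (l3 : 2 < l) (kV : k.+1 < #|V|).

(** The exceptional families below are bounded in terms of [b]; the contradiction will come from [b]
    being tiny compared with [#|SS|]. *)
Let b := #|ksets k.+1 :\: SS|.

Lemma Scvx X : X \in SS -> cvx X.
Proof. by move/(subsetP Sk)/ksetsP => []. Qed.

Lemma Scard X : X \in SS -> #|X| = k.+1.
Proof. by move/(subsetP Sk)/ksetsP => []. Qed.

Lemma Sk3 X : X \in SS -> 2 < k.
Proof.
move=> XS; have := nonstar_card (Scvx XS) (Sn XS).
by rewrite (Scard XS) => /(_ isT).
Qed.

Lemma Sbd X : X \in SS -> 0 < #|bd X|.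
Proof.
by move=> XS; apply: bd_gt0; rewrite -?card_gt0 (Scard XS).
Qed.

Definition goods U := [set y in bd U | y |: U \in SS].
Definition bads U := [set y in bd U | y |: U \notin SS].

Lemma goodsP U y : reflect (y \in bd U /\ y |: U \in SS) (y \in goods U).
Proof. exact: setIdP. Qed.

Lemma rem_goods H z : H \in SS -> z \in leaves H -> z \in goods (H :\ z).
Proof. by move=> HS zL; apply/goodsP; rewrite rem_bd // (remK zL). Qed.

Lemma goods_bads U : #|goods U| + #|bads U| = #|bd U|.
Proof.
rewrite -(cardsID [set y | y |: U \in SS] (bd U)); congr (_ + _).
  by apply: eq_card => y; rewrite /goods in_set in_setI in_set.
by apply: eq_card => y; rewrite /bads in_set in_setD in_set andbC.
Qed.

Lemma ksets_cvx j U : U \in ksets j -> cvx U. Proof. by case/ksetsP. Qed.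
Lemma ksets_card j U : U \in ksets j -> #|U| = j. Proof. by case/ksetsP. Qed.

Lemma good_k U y : U \in ksets k -> y \in goods U -> 1 < #|U|.
Proof.
by move=> /ksets_card -> /goodsP[_ /Sk3]; apply: ltn_trans.
Qed.

(** Adding a leaf never lowers the number of leaves. *)
Lemma good_leaves U y : U \in ksets k -> y \in goods U -> #|leaves U| <= l.
Proof.
move=> Uk yG; have U2 := good_k Uk yG; have /goodsP[yU yS] := yG.
rewrite -(Sl yS); have := card_leaves_ext (ksets_cvx Uk) yU U2.
by case: (_ \in _); lia.
Qed.

Lemma good_deg U y z : U \in ksets k -> y \in goods U -> z \in goods U ->
  deg U (att U y) = deg U (att U z).
Proof.
move=> /ksets_cvx cU /setIdP[yU yS] /setIdP[zU zS].
by have := Sq yS; rewrite -(Sq zS) !qs_ext //; lia.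
Qed.

Lemma good_ds U y z : U \in ksets k -> y \in goods U -> z \in goods U ->
  ds U (att U y) = ds U (att U z).
Proof.
move=> /ksets_cvx cU /setIdP[yU yS] /setIdP[zU zS].
have := Sw yS; rewrite -(Sw zS) !wn_ext ?(bd_notin yU) ?(bd_notin zU) //.
by rewrite (ds_att cU yU) (ds_att cU zU); lia.
Qed.

Lemma Srem H z : H \in SS -> z \in leaves H -> H :\ z \in ksets k.
Proof. by move=> /(subsetP Sk); apply: rem_ksets. Qed.

(* All copies have the same sum of squared degrees. *)
Lemma swap_bad H z y : H \in SS -> z \in leaves H -> y \in bd (H :\ z) ->
  deg (H :\ z) (att (H :\ z) y) != deg (H :\ z) (att H z) ->
  y |: (H :\ z) \notin SS.
Proof.
move=> HS zL yU; apply: contraNN => yS; apply/eqP.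
rewrite -(att_rem zL); apply: good_deg (Srem HS zL) _ (rem_goods HS zL).
by apply/goodsP.
Qed.

(** A bad pair is a subtree [H] outside [SS] with one of its leaves. If some [H :\ z] has a good
    extension, then [H :\ z] has at most [l] leaves and [H] at most [l + 1], so each of the [b]
    subtrees is counted at most that often. *)
Lemma sum_bads : \sum_(U in ksets k | 0 < #|goods U|) #|bads U| <= l.+1 * b.
Proof.
have -> : \sum_(U in ksets k | 0 < #|goods U|) #|bads U| =
   \sum_(U in ksets k) \sum_(y in bd U) ((0 < #|goods U|) && (y |: U \notin SS)).
  rewrite [LHS]big_mkcondr /=; apply: eq_bigr => U _.
  case: ifP => _; last by rewrite big1.
  rewrite -sum1_card big_mkcond [RHS]big_mkcond; apply: eq_bigr => y _.
  by rewrite /bads in_set; case: (y \in bd U); case: (y |: U \in SS).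
rewrite -(edge_sum _ _ _ (fun U y => ((0 < #|goods U|) && (y |: U \notin SS) : nat))).
have -> : l.+1 * b = \sum_(H in ksets k.+1 | H \notin SS) l.+1.
  rewrite sum_nat_cond_const mulnC; congr (_ * _).
  by apply: eq_card => H; rewrite !inE andbC.
rewrite (bigID (mem SS)) /= big1 ?add0n; last first.
  move=> H /andP[_ HS]; rewrite big1 // => z zL.
  by rewrite (remK zL) HS andbF.
apply: leq_sum => H /andP[Hk HS].
have [h0|] := posnP (\sum_(z in leaves H) (0 < #|goods (H :\ z)|)).
  apply: (leq_trans (n := \sum_(z in leaves H) (0 < #|goods (H :\ z)|))).
    by apply: leq_sum => z _; case: (0 < _) => //=; case: (_ \notin _).
  by rewrite h0.
rewrite lt0n sum_nat_eq0 negb_forall_in => /exists_inP[z zL].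
rewrite eqb0 negbK => /card_gt0P[y yG].
have Uk := rem_ksets Hk zL.
have := card_leaves_ext (ksets_cvx Uk) (rem_bd zL) (good_k Uk yG).
have := good_leaves Uk yG; rewrite (remK zL) => le1 le2.
apply: (leq_trans (n := \sum_(z in leaves H) 1)).
  by apply: leq_sum => z' _; case: ((0 < _) && _).
by rewrite sum1_card; lia.
Qed.

(* The boundary of [H] rather than that of [H :\ z], so that the same boundary
   vertices are counted for all leaves [z]. *)
Definition escapes H := \sum_(z in leaves H) #|bd H :&: bads (H :\ z)|.

Section Reals.
Variable R : realFieldType.
Local Open Scope ring_scope.

(** Since [#|bd (H :\ z)| <= 2 * #|bd H|], the share of escapes at [H] due to [z] is at most twice
    the share of bad vertices at [H :\ z]. Each [U] receives that share from at most [#|bd U|] good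
    extensions, which cancels the denominator and leaves [sum_bads]. *)
Lemma sum_escapes :
  \sum_(H in SS) ((escapes H)%:R / #|bd H|%:R : R) <= (4 * l * b)%N%:R.
Proof.
pose f U : R := #|bads U|%:R / #|bd U|%:R.
have le1 H : H \in SS -> (escapes H)%:R / #|bd H|%:R <= \sum_(z in leaves H) 2 * f (H :\ z).
  move=> HS; rewrite /escapes natr_sum mulr_suml; apply: ler_sum => z zL.
  have N0 : 0 < #|bd H|%:R :> R by rewrite ltr0n Sbd.
  have M0 : 0 < #|bd (H :\ z)|%:R :> R.
    by rewrite ltr0n; apply/card_gt0P; exists z; apply: rem_bd.
  rewrite ler_pdivrMr // /f mulrA mulrAC ler_pdivlMr // mulrC.
  rewrite -!natrM ler_nat.
  have := card_bd_rem zL (Scvx HS); have := Sbd HS.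
  have := subset_leq_card (subsetIr (bd H) (bads (H :\ z))); nia.
apply: le_trans (ler_sum _ _) _; first by move=> H HS; exact: le1.
have -> : \sum_(H in SS) \sum_(z in leaves H) 2 * f (H :\ z) =
  \sum_(H in ksets k.+1) \sum_(z in leaves H)
     (if z |: (H :\ z) \in SS then 2 * f (H :\ z) else 0).
  rewrite [RHS](bigID (mem SS)) /= [X in _ = _ + X]big1 ?addr0; last first.
    move=> H /andP[_ HS]; rewrite big1 // => z zL.
    by rewrite (remK zL) (negPf HS).
  apply: eq_big => [H|H HS].
    by have [/(subsetP Sk) ->|] := boolP (H \in SS); rewrite ?andbF.
  by apply: eq_bigr => z zL; rewrite (remK zL) HS.
rewrite (edge_sum _ _ _ (fun U z => if z |: U \in SS then 2 * f U else 0 : R)).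
apply: le_trans (_ : (2 * (l.+1 * b))%N%:R <= _); last by rewrite ler_nat; nia.
rewrite natrM; apply: le_trans (_ : 2 * (\sum_(U in ksets k | (0 < #|goods U|)%N) #|bads U|)%N%:R <= _);
  last by rewrite ler_pM2l // ler_nat sum_bads.
rewrite natr_sum mulr_sumr [leRHS]big_mkcondr /=; apply: ler_sum => U Uk.
rewrite -big_mkcondr /= (eq_bigl (mem (goods U))); last by move=> y; rewrite !inE.
rewrite sumr_const; case: posnP => [->|g0]; first by rewrite mulr0n.
have N0 : 0 < #|bd U|%:R :> R.
  rewrite ltr0n; case/card_gt0P: g0 => y /goodsP[yU _]; apply/card_gt0P; by exists y.
rewrite /f -[_ *+ #|_|]mulr_natl mulrCA ler_pM2l // mulrA ler_pdivrMr // mulrC.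
by rewrite ler_wpM2l ?ler0n // ler_nat -goods_bads leq_addr.
Qed.

(** Markov's inequality for [sum_escapes]; the factor [l] cancels because [escapes] sums over [l]
    leaves. *)
Lemma escapes_markov (P : {set {set V}}) (c : R) : P \subset SS -> 0 <= c ->
  {in P, forall H, c * #|bd H|%:R * l%:R <= (escapes H)%:R} ->
  c * #|P|%:R <= 4 * b%:R.
Proof.
move=> PS c0 hP; have l0 : 0 < l%:R :> R by rewrite ltr0n; lia.
rewrite -(ler_pM2r l0) -mulrA [4 * _ * _]mulrAC.
apply: le_trans (_ : (4 * l * b)%N%:R <= _); last by rewrite !natrM.
apply: le_trans sum_escapes; rewrite (big_setID P) /= (setIidPr PS).
rewrite -[X in X <= _]addr0; apply: lerD; last first.
  by apply: sumr_ge0 => H _; rewrite divr_ge0.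
rewrite (_ : _ * _ = \sum_(H in P) c * l%:R); last first.
  by rewrite sumr_const -[RHS]mulr_natr; ring.
apply: ler_sum => H HP.
have N0 : 0 < #|bd H|%:R :> R by rewrite ltr0n Sbd // (subsetP PS).
by rewrite ler_pdivlMr // mulrAC hP.
Qed.
End Reals.

Definition nl X v := #|[set x in leaves X | (x != v) && ~~ e x v]|.
(** Weak enough to survive one exchange in a starlike copy, yet strong enough to make the centre
    unique; so subtrees outside [SS] can be charged to their centres without repetition. *)
Definition center X v := (v \in X) && (nl X v < mv X v).

Lemma mv_gt0 X v : v \in X -> 0 < mv X v -> exists2 x, x \in leaves X & att X x = v.
Proof.
move=> vX; rewrite mvE // => /card_gt0P[x /setIdP[xL /eqP ax]]; by exists x.
Qed.

(** The leaves at [v'] do not hang at [v], so [mv X v' <= nl X v < mv X v]; by symmetry [v] may be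
    assumed to carry no more leaves than [v']. *)
Lemma center_uniq X v v' : cvx X -> 2 < #|X| -> center X v -> center X v' -> v = v'.
Proof.
move=> cX X3; wlog le : v v' / mv X v <= mv X v' => [hw h h'|].
  have [le|/ltnW le] := leqP (mv X v) (mv X v'); first exact: hw.
  exact/esym/hw.
move=> /andP[vX cv] /andP[v'X cv']; apply/eqP/negPn/negP => ne.
have [x xL ax] := mv_gt0 vX (leq_ltn_trans (leq0n _) cv).
suff : mv X v' <= nl X v by lia.
apply: subset_leq_card; apply/subsetP => y /setIdP[yL yv'].
apply/setIdP; split=> //; apply/andP; split.
  by apply: contraTneq yL => ->; rewrite -ax leaf_att_notleaf.
rewrite (leaf_att_eq yL) //; move: yv'; rewrite (leaf_att_eq yL) // => /eqP <-.
by [].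
Qed.

Lemma mv_nl X v : v \in X -> v \notin leaves X -> mv X v + nl X v = #|leaves X|.
Proof.
move=> vX vL; rewrite -(cardsID [set x | e x v] (leaves X)); congr (_ + _).
  apply: eq_card => x; rewrite in_setI.
  by apply/setIdP/andP => -[xL xv]; split=> //; move: xv; rewrite inE.
apply: eq_card => x; rewrite in_setD andbC.
apply/setIdP/andP => [[xL /andP[_ xv]]|[xL]]; first by split; rewrite // inE.
rewrite inE => xv; split=> //; rewrite xv andbT.
by apply: contraNneq vL => <-.
Qed.

Lemma mx_attained X : X != set0 -> exists2 v, v \in X & mv X v = mx X.
Proof.
rewrite -card_gt0 /mx => X0.
by have [v vX ->] := eq_bigmax_cond (mv X) X0; exists v.
Qed.

Lemma leq_mv_mx X v : v \in X -> mv X v <= mx X.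
Proof. by move=> vX; apply: (leq_bigmax_cond (F := mv X)). Qed.

Lemma sum_out_le X (P : {set V}) : cvx X -> P \subset X -> \sum_(v in P) out X v <= #|bd X|.
Proof.
by move=> cX PX; rewrite sum_out //; apply: subset_leq_card; apply/subsetP => y /setIdP[].
Qed.

Lemma card_setId_split (I : finType) (A : {set I}) (P Q : pred I) :
  #|[set y in A | P y]| = #|[set y in A | P y && Q y]| + #|[set y in A | P y && ~~ Q y]|.
Proof.
rewrite -!sum1_card (bigID Q) /=; congr (_ + _); apply: eq_bigl => y;
  by rewrite 2!in_set andbA.
Qed.

Lemma card_setId_compl (I : finType) (A : {set I}) (Q : pred I) :
  #|A| = #|[set y in A | Q y]| + #|[set y in A | ~~ Q y]|.
Proof.
by rewrite -(card_setId_split A predT Q); apply: eq_card => y; rewrite in_set andbT.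
Qed.

Lemma card_bd_elsewhere X v : cvx X -> v \in X ->
  #|[set y in bd X | att X y != v]| + out X v = #|bd X|.
Proof.
move=> cX vX; rewrite outE // addnC.
by rewrite -(card_setId_compl (bd X) (fun y => att X y == v)).
Qed.

Lemma card_bd_elsewhere2 X v x : cvx X -> v \in X -> x \in X -> v != x ->
  #|[set y in bd X | (att X y != v) && (att X y != x)]| + out X x + out X v = #|bd X|.
Proof.
move=> cX vX xX vx; rewrite -(card_bd_elsewhere cX vX); congr (_ + _).
rewrite (card_setId_split _ (fun y => att X y != v) (fun y => att X y == x)) addnC.
congr (_ + _); rewrite outE //; apply: eq_card => y; rewrite 2!in_set.
by have [->|] := eqVneq (att X y) x; rewrite ?andbF // eq_sym vx.
Qed.

(** Here [m - 1] is at least half of [l], and [N - o] at least half of [N]. *)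
Lemma arith_few_out E o N : 17 * l <= 20 * m -> m < l -> o < l -> 2 * l <= N ->
  (m - 1) * (N - o) <= E -> l * N <= 4 * E.
Proof. clear; nia. Qed.

(** The choice of the factor 12: [6 * (m + 2) <= 12 * (m - 1)] on one side and
    [(j + 2) * (o + 1) <= 6 * j * o] on the other, where [j = l - m]. The final factor 3 pays for
    [N' - o <= (N - o) + 1]. *)
Lemma arith_kept o N N' c : 17 * l <= 20 * m -> 6 < l -> m < l -> l <= o ->
  (l - m + 2) * o.+1 >= 12 * ((m - 1) * (N - o)) -> N.+1 = N' + c ->
  (m + 2) * (N' - o) <= 3 * (l - m) * o.
Proof.
clear => st l7 ml lo le1 eN; have a1 : N' - o <= N - o + 1 by lia.
set A := N - o in le1 a1; set j := l - m in le1 *.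
have j1 : 0 < j by rewrite /j; lia.
have m4 : m + 2 <= 2 * (m - 1) by lia.
have le2 : 6 * ((m + 2) * A) <= 12 * ((m - 1) * A).
  by rewrite -[12]/(6 * 2) -mulnA leq_mul2l /= mulnA leq_mul2r m4 orbT.
have le3 : (j + 2) * o.+1 <= (3 * j) * (2 * o) by apply: leq_mul; lia.
have le4 : (m + 2) * A <= j * o.
  rewrite mulnACA in le3; move: (leq_trans le2 (leq_trans le1 le3)).
  by rewrite -[3 * 2]/6 leq_mul2l.
have le5 : m + 2 <= 2 * (j * o) by have := leq_pmull o j1; lia.
apply: leq_trans (_ : (m + 2) * (A + 1) <= _); first by rewrite leq_mul2l a1 orbT.
by rewrite mulnDr muln1; lia.
Qed.

(** * Starlike copies: at least 17/20 of the leaves at one vertex *)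

Section Starlike.
Hypothesis star : 17 * l <= 20 * m.

Lemma m_lt_l H : H \in SS -> m < l.
Proof.
move=> HS; rewrite -(Sm HS) -(Sl HS).
have [|v vH <-] := @mx_attained H; first by rewrite -card_gt0 (Scard HS).
exact: mv_lt_leaves (Scvx HS) (Sn HS) vH.
Qed.

(** The gap satisfies [20 <= 20 * (l - m) <= 3 * l]. *)
Lemma l_ge7 H : H \in SS -> 6 < l.
Proof. by move/m_lt_l; lia. Qed.

Section Center.
Variables (H : {set V}) (v : V).
Hypotheses (HS : H \in SS) (vH : v \in H) (vm : mv H v = m).
Let cH := Scvx HS.
Let H3 : 2 < #|H|.
Proof. by rewrite (Scard HS); have := Sk3 HS; lia. Qed.

Lemma center_deg : m < deg H v.
Proof. by rewrite -vm mv_lt_deg // Sn. Qed.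

Lemma other_deg u : u \in H -> u != v -> deg H u + m <= l + 1.
Proof.
move=> uH uv; have := deg_pair cH uH vH uv; rewrite (Sl HS).
have := center_deg; clear; lia.
Qed.

Lemma center_notleaf : v \notin leaves H.
Proof.
apply/negP => /leavesP[_ dv]; have := center_deg; rewrite dv.
have := l_ge7 HS; move: star; clear; lia.
Qed.

Lemma center_nl : nl H v = l - m.
Proof. by rewrite -(Sl HS) -(mv_nl vH center_notleaf) vm addKn. Qed.

(** Even without [x], the degree of [v] is at least [m], while that of any other vertex is at most
    [l + 1 - m], which is smaller. So the exchange changes the squared degrees. *)
Lemma move_out x w : x \in leaves H -> att H x = v ->
  w \in bd H -> att H w != v -> att H w != x ->
  [/\ w \in bd (H :\ x), att (H :\ x) w = att H w & w |: (H :\ x) \notin SS].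
Proof.
move=> xL ax wH wv wx; have [wR aw] := bd_rem_keep cH xL wH wx.
split=> //; apply: swap_bad => //; rewrite aw ax.
have [aH _] := attP wH; have aR : att H w \in H :\ x by rewrite !inE wx.
have vR : v \in H :\ x by rewrite -ax att_in_rem.
have := deg_rem xL cH vR; rewrite ax eqxx; have := deg_rem xL cH aR.
rewrite ax (negPf wv); have := other_deg aH wv; have := center_deg.
have := l_ge7 HS; move: star; clear; lia.
Qed.

Lemma move_in z y : z \in leaves H -> att H z != v ->
  y \in bd (H :\ z) -> att (H :\ z) y = v -> y |: (H :\ z) \notin SS.
Proof.
move=> zL az yR ay; apply: swap_bad => //; rewrite ay.
have zv : v != z by apply: contraNneq center_notleaf => ->.
have vR : v \in H :\ z by rewrite !inE zv.
have aR := att_in_rem zL; have [aH _] := leaf_att zL.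
have := deg_rem zL cH vR; rewrite eq_sym (negPf az).
have := deg_rem zL cH aR; rewrite eqxx.
have := other_deg aH az; have := center_deg; have := l_ge7 HS; move: star; clear; lia.
Qed.

(** The [m] leaves at [v] have disjoint sets of outer neighbours, all away from [v]. Hence excluding
    the neighbours of the moved leaf costs at most [#|bd H| - out H v] in total, as much as one of
    the [m] leaves. *)
Lemma sum_move_out :
  (m - 1) * (#|bd H| - out H v) <=
  \sum_(x in leaves H | att H x == v)
     #|[set y in bd H | (att H y != v) && (att H y != x)]|.
Proof.
pose L := [set x in leaves H | att H x == v].
have Lm : #|L| = m by rewrite -vm mvE.
have LH : v |: L \subset H.
  by rewrite subUset sub1set vH; apply/subsetP => x /setIdP[/leaf_in].
have vL : v \notin L by rewrite inE (negPf center_notleaf).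
have := sum_out_le cH LH; rewrite big_setU1 //= => le1.
have : \sum_(x in L) (#|[set y in bd H | (att H y != v) && (att H y != x)]| + out H x) =
  m * (#|bd H| - out H v).
  rewrite -Lm -sum_nat_const; apply: eq_bigr => x xL.
  have xH : x \in H by apply: (subsetP LH); rewrite inE xL orbT.
  rewrite -(card_bd_elsewhere2 cH vH xH) ?addnK //.
  by apply: contraNneq vL => ->.
rewrite big_split /= => eq1.
rewrite (eq_bigl (mem L)); last by move=> x; apply/andP/setIdP.
set s1 := \sum_(x in L) _ in eq1 *; set s2 := \sum_(x in L) out H x in eq1 le1.
have : 0 < m by have := l_ge7 HS; move: star; clear; lia.
rewrite mulnBl mul1n -eq1; move: le1; clear; lia.
Qed.

Lemma few_out_escapes : out H v < l -> 2 * l <= #|bd H| ->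
  l * #|bd H| <= 4 * escapes H.
Proof.
move=> ol N2; have := sum_move_out.
have : \sum_(x in leaves H | att H x == v)
    #|[set y in bd H | (att H y != v) && (att H y != x)]| <= escapes H.
  rewrite /escapes big_mkcondr /=; apply: leq_sum => x xL.
  case: ifP => // /eqP ax; apply: subset_leq_card; apply/subsetP => w.
  move=> /setIdP[wH /andP[wv wx]].
  have [wR _ wS] := move_out xL ax wH wv wx.
  by apply/setIP; split; [|apply/setIdP].
by move=> le1 le2; apply: arith_few_out (leq_trans le2 le1); rewrite ?(m_lt_l HS).
Qed.
End Center.
Lemma leaves_rem_sub H x y : H \in SS -> x \in leaves H -> y \in leaves H -> y != x ->
  y \in leaves (H :\ x).
Proof.
move=> HS xL yL yx; have Uk := Srem HS xL.
have := leaves_ext (ksets_cvx Uk) (rem_bd xL) (good_k Uk (rem_goods HS xL)).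
rewrite (remK xL) => h; move: yL; rewrite h => /setU1P[/eqP|/setD1P[]//].
by rewrite (negPf yx).
Qed.

Lemma leaves_rem_sup H x y : H \in SS -> x \in leaves H -> y \in leaves (H :\ x) ->
  y != att H x -> y \in leaves H.
Proof.
move=> HS xL yL ya; have Uk := Srem HS xL.
have := leaves_ext (ksets_cvx Uk) (rem_bd xL) (good_k Uk (rem_goods HS xL)).
rewrite (remK xL) (att_rem xL) => ->.
by apply/setU1P; right; apply/setD1P.
Qed.

Lemma leaves_ext_sub U y z : cvx U -> 1 < #|U| -> y \in bd U -> z \in leaves (y |: U) ->
  z != y -> z \in leaves U.
Proof.
move=> cU U2 yU; rewrite leaves_ext // => /setU1P[->|/setD1P[]//].
by rewrite eqxx.
Qed.

Lemma leaves_ext_sup U y z : cvx U -> 1 < #|U| -> y \in bd U -> z \in leaves U ->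
  z != att U y -> z \in leaves (y |: U).
Proof.
by move=> cU U2 yU zL za; rewrite leaves_ext //; apply/setU1P; right; apply/setD1P.
Qed.

Lemma card_sub_setU1 (A B : {set V}) x : A \subset x |: B -> #|A| <= #|B|.+1.
Proof.
move/subset_leq_card/leq_trans; apply; rewrite cardsU1.
by case: (_ \notin _); rewrite ?add1n ?add0n.
Qed.

Lemma center_move_out H v x w : H \in SS -> v \in H -> mv H v = m ->
  x \in leaves H -> att H x = v -> w \in bd (H :\ x) -> att (H :\ x) w != v ->
  center (w |: (H :\ x)) v /\ nl (w |: (H :\ x)) v <= l - m + 1.
Proof.
move=> HS vH vm xL ax wU aw; have Uk := Srem HS xL; have cU := ksets_cvx Uk.
have U2 := good_k Uk (rem_goods HS xL).
have vU : v \in H :\ x by rewrite -ax att_in_rem.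
have n1 : nl (w |: (H :\ x)) v <= l - m + 1.
  rewrite -(center_nl HS vH vm) addn1; apply: (@card_sub_setU1 _ _ w).
  apply/subsetP => y /setIdP[yL /andP[yv yNv]]; apply/setU1P.
  have [->|yw] := eqVneq y w; [by left|right]; apply/setIdP; rewrite yv yNv; split=> //.
  by apply: (leaves_rem_sup HS xL (leaves_ext_sub cU U2 wU yL yw)); rewrite ax.
have m1 : m <= (mv (w |: (H :\ x)) v).+2.
  rewrite -vm; apply: (leq_trans (n := #|x |: [set y in leaves (w |: (H :\ x)) | e y v]|.+1)).
    apply: (@card_sub_setU1 _ _ (att (H :\ x) w)).
    apply/subsetP => y /setIdP[yL yv]; apply/setU1P.
    have [->|ya] := eqVneq y (att (H :\ x) w); [by left|right]; apply/setU1P.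
    have [->|yx] := eqVneq y x; [by left|right]; apply/setIdP; split=> //.
    exact: leaves_ext_sup cU U2 wU (leaves_rem_sub HS xL yL yx) ya.
  by rewrite ltnS; apply: card_sub_setU1.
split=> //; rewrite /center mem_ext //=.
by have := m_lt_l HS; have := l_ge7 HS; move: star n1 m1; clear; lia.
Qed.

Lemma center_move_in H v z y : H \in SS -> v \in H -> mv H v = m ->
  z \in leaves H -> att H z != v -> y \in bd (H :\ z) -> att (H :\ z) y = v ->
  center (y |: (H :\ z)) v /\ mv (y |: (H :\ z)) v <= m + 2.
Proof.
move=> HS vH vm zL az yU ay; have Uk := Srem HS zL; have cU := ksets_cvx Uk.
have U2 := good_k Uk (rem_goods HS zL).
have vL := center_notleaf HS vH vm.
have zv : v != z by apply: contraNneq vL => ->.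
have vU : v \in H :\ z by rewrite !inE zv.
have n1 : nl (y |: (H :\ z)) v <= l - m + 1.
  rewrite -(center_nl HS vH vm) addn1; apply: (@card_sub_setU1 _ _ (att H z)).
  apply/subsetP => u /setIdP[uL /andP[uv uNv]]; apply/setU1P.
  have [->|ua] := eqVneq u (att H z); [by left|right].
  have uy : u != y.
    by apply: contraNneq uNv => ->; rewrite (att_eq cU yU) // ay.
  apply/setIdP; rewrite uv uNv; split=> //.
  exact: (leaves_rem_sup HS zL (leaves_ext_sub cU U2 yU uL uy)).
have m1 : m <= mv (y |: (H :\ z)) v.
  rewrite -vm; apply: subset_leq_card; apply/subsetP => u /setIdP[uL uv].
  apply/setIdP; split=> //; have uz : u != z.
    by apply: contraNneq az => uz; rewrite eq_sym -(leaf_att_eq zL vH) -uz.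
  apply: leaves_ext_sup (leaves_rem_sub HS zL uL uz) _ => //.
  by rewrite ay (edge_neq uv).
have m2 : mv (y |: (H :\ z)) v <= m + 2.
  rewrite -vm addn2; apply: (leq_trans (n := #|y |: [set u in leaves H | e u v]|.+1)).
    apply: (@card_sub_setU1 _ _ (att H z)).
    apply/subsetP => u /setIdP[uL uv]; apply/setU1P.
    have [->|ua] := eqVneq u (att H z); [by left|right]; apply/setU1P.
    have [->|uy] := eqVneq u y; [by left|right]; apply/setIdP; split=> //.
    exact: (leaves_rem_sup HS zL (leaves_ext_sub cU U2 yU uL uy)).
  by rewrite ltnS; apply: card_sub_setU1.
split=> //; rewrite /center mem_ext //=.
by have := m_lt_l HS; have := l_ge7 HS; move: star n1 m1; clear; lia.
Qed.

Section FixCenter.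
Variable v : V.
Definition manyout := [set H in SS | [&& v \in H, mv H v == m & l <= out H v]].
(** Copies with enough boundary away from [v] to be charged by moving leaves away from [v]; the
    others are charged by moving leaves to [v]. *)
Definition spill := [set H in manyout |
  (l - m + 2) * (out H v).+1 < 12 * ((m - 1) * (#|bd H| - out H v))].
Definition centered := [set X in ksets k.+1 :\: SS | center X v].

Lemma manyoutP H : H \in manyout ->
  [/\ H \in SS, v \in H, mv H v = m & l <= out H v].
Proof. by case/setIdP => HS /and3P[vH /eqP vm lo]. Qed.

Section Weights.
Variable R : realFieldType.
Local Open Scope ring_scope.

(* With the weight [1 / out U v], the neighbours of [v] outside [U] have total
   weight at most 1, whatever the degree of [v]. *)
Let F2 U x w : R :=
  if [&& x |: U \in manyout, att U x == v, att U w != v & w |: U \notin SS]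
  then (out U v)%:R^-1 else 0.

Lemma F2_ge0 U x w : 0 <= F2 U x w.
Proof. by rewrite /F2; case: ifP; rewrite ?invr_ge0. Qed.

(** At least [(m - 1) * (#|bd H| - out H v)] exchanges, each of weight [1 / (out H v + 1)] because
    removing [x] gives [v] one more outer neighbour. *)
Lemma spill_lower H : H \in spill ->
  (l - m + 2)%N%:R / 12 <= \sum_(x in leaves H) \sum_(w in bd (H :\ x)) F2 (H :\ x) x w.
Proof.
case/setIdP => HM; have [HS vH vm lo] := manyoutP HM; move=> sp.
have o0 : 0 < (out H v).+1%:R :> R by rewrite ltr0n.
apply: le_trans (_ : ((m - 1) * (#|bd H| - out H v))%N%:R / (out H v).+1%:R <= _).
  rewrite ler_pdivrMr // mulrAC ler_pdivlMr // -!natrM ler_nat; apply: ltnW.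
  by rewrite [(_ * 12)%N]mulnC.
rewrite ler_pdivrMr //; have := sum_move_out HS vH vm.
rewrite -(ler_nat R) => /le_trans; apply.
rewrite natr_sum mulr_suml big_mkcondr /=; apply: ler_sum => x xL.
case: ifP => [/eqP ax|_]; last first.
  by rewrite mulr_ge0 ?ler0n // sumr_ge0 // => w _; apply: F2_ge0.
rewrite -sum1_card natr_sum mulr_suml.
rewrite [leRHS](bigID (mem [set y in bd H | (att H y != v) && (att H y != x)])) /=.
rewrite -[leLHS]addr0; apply: lerD; last first.
  by apply: sumr_ge0 => w _; rewrite mulr_ge0 ?F2_ge0 ?ler0n.
rewrite [leRHS](eq_bigl (mem [set y in bd H | (att H y != v) && (att H y != x)])) /=.
  apply: ler_sum => w /setIdP[wH /andP[wv wx]].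
  have [wR aw wS] := move_out HS vH vm xL ax wH wv wx.
  rewrite /F2 (remK xL) HM (att_rem xL) ax eqxx aw wv wS /=.
  rewrite (out_rem xL (Scvx HS)) ?ax ?eqxx ?addn1 ?mulVf ?gt_eqF //.
  by rewrite -ax att_in_rem.
move=> w; apply/andP/idP => [[]//|h]; split=> //.
case/setIdP: h => wH /andP[wv wx].
by have [] := move_out HS vH vm xL ax wH wv wx.
Qed.

(** For a given new leaf [w], the old leaf [x] ranges over outer neighbours of [v], of total weight
    at most 1; and [w] is one of the [nl H v] leaves away from [v]. *)
Lemma centered_upper H : H \in ksets k.+1 ->
  \sum_(w in leaves H) \sum_(x in bd (H :\ w)) F2 (H :\ w) x w <=
  (if H \in centered then (l - m + 2)%N%:R else 0).
Proof.
move=> Hk.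
have key w x : w \in leaves H -> x \in bd (H :\ w) -> F2 (H :\ w) x w != 0 ->
   [/\ H \in centered, (nl H v <= l - m + 2)%N, w != v & ~~ e w v].
  move=> wL xU; rewrite /F2; case: ifP; last by rewrite eqxx.
  case/and4P => HM /eqP ax aw wS _; have [HS vH vm lo] := manyoutP HM.
  have Uk := rem_ksets Hk wL; have cU := ksets_cvx Uk.
  have xL : x \in leaves (x |: (H :\ w)) by apply: ext_leaf.
  have U2 := good_k Uk (y := x); rewrite (remK wL) in wS.
  have vU : v \in H :\ w by rewrite -ax; case: (attP xU).
  have := center_move_out (w := w) HS vH vm xL.
  rewrite (extK xU) att_ext // ?(remK wL).
  case/(_ ax (rem_bd wL) aw) => ce n1; split.
  - by apply/setIdP; split=> //; apply/setDP.
  - by apply: leq_trans n1 _; rewrite leq_add2l.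
  - by apply: contraTneq vU => ->; rewrite !inE eqxx.
  - by rewrite (att_eq cU (rem_bd wL)) // eq_sym.
have [/eqP ->|] := boolP (\sum_(w in leaves H) \sum_(x in bd (H :\ w)) F2 (H :\ w) x w == 0).
  by case: ifP.
rewrite psumr_neq0; last by move=> w _; apply: sumr_ge0 => x _; apply: F2_ge0.
case/hasP => w1 _ /andP[w1L]; rewrite lt0r => /andP[+ _].
rewrite psumr_neq0; last by move=> x _; apply: F2_ge0.
case/hasP => x0 _ /andP[x0U]; rewrite lt0r => /andP[F0 _].
have [HC n1 _ _] := key _ _ w1L x0U F0; rewrite HC.
apply: le_trans (_ : (nl H v)%:R <= _); last by rewrite ler_nat.
rewrite /nl -sum1_card natr_sum.
rewrite [leRHS](eq_bigl (fun w => (w \in leaves H) && ((w != v) && ~~ e w v))); last first.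
  by move=> w; apply/setIdP/andP.
rewrite [leRHS]big_mkcondr /=; apply: ler_sum => w wL.
case: ifP => [_|h]; last first.
  rewrite big1 // => x xU; apply/eqP; apply: contraFT h => F1.
  by have [_ _ -> ->] := key _ _ wL xU F1.
have [v_in|v_out] := boolP (v \in H :\ w); last first.
  rewrite big1 // => x xU; rewrite /F2; case: ifP => // /and4P[_ /eqP ax _ _].
  by case/negP: v_out; rewrite -ax; case: (attP xU).
have Uk := rem_ksets Hk wL; have cU := ksets_cvx Uk.
apply: le_trans (_ : \sum_(x in bd (H :\ w) | att (H :\ w) x == v) (out (H :\ w) v)%:R^-1 <= _).
  rewrite [leRHS]big_mkcondr /=; apply: ler_sum => x xU; rewrite /F2.
  by case: (att _ x == v); rewrite ?andbF //=; case: ifP; rewrite ?invr_ge0.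
rewrite sumr_const; have -> : #|[pred x | (x \in bd (H :\ w)) & att (H :\ w) x == v]| = out (H :\ w) v.
  by rewrite outE //; apply: eq_card => x; rewrite [RHS]in_set.
rewrite -[_ *+ out _ _]mulr_natl; have [->|o0] := posnP (out (H :\ w) v); first by rewrite mul0r.
by rewrite mulfV // gt_eqF // ltr0n.
Qed.

Lemma card_spill : #|spill|%:R <= 12 * #|centered|%:R :> R.
Proof.
have j0 : 0 < (l - m + 2)%N%:R :> R by rewrite ltr0n addn2.
rewrite -(ler_pM2r j0).
have -> : #|spill|%:R * (l - m + 2)%N%:R =
  12 * \sum_(H in spill) (l - m + 2)%N%:R / 12 :> R.
  by rewrite sumr_const -[_ *+ #|_|]mulr_natr; field.
rewrite -mulrA ler_pM2l //.
apply: le_trans (_ : \sum_(H in ksets k.+1) (if H \in centered then (l - m + 2)%N%:R else 0) <= _).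
  apply: le_trans (ler_sum _ centered_upper); rewrite -(swap_sum _ _ k F2).
  rewrite [leRHS](bigID (mem spill)) /= -[leLHS]addr0; apply: lerD; last first.
    by apply: sumr_ge0 => H _; apply: sumr_ge0 => x _; apply: sumr_ge0 => w _; apply: F2_ge0.
  rewrite [leRHS](eq_bigl (mem spill)); first by apply: ler_sum => H; apply: spill_lower.
  move=> H; apply/andP/idP => [[]//|HP]; split=> //.
  by case/setIdP: HP => /manyoutP[/(subsetP Sk)].
rewrite -big_mkcondr /= (eq_bigl (mem centered)); last first.
  move=> H; apply/andP/idP => [[]//|HC]; split=> //.
  by case/setIdP: HC => /setDP[].
by rewrite sumr_const -[_ *+ #|_|]mulr_natl.
Qed.

(** The opposite exchange, with the same weight: [y] hangs at [v] and replaces a leaf [z] that hangs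
    elsewhere. *)
Let F1 U z y : R :=
  if [&& z |: U \in manyout :\: spill, att U z != v, att U y == v & y |: U \notin SS]
  then (out U v)%:R^-1 else 0.

Lemma F1_ge0 U z y : 0 <= F1 U z y.
Proof. by rewrite /F1; case: ifP; rewrite ?invr_ge0. Qed.

Lemma kept_lower H : H \in manyout :\: spill ->
  (l - m)%N%:R <= \sum_(z in leaves H) \sum_(y in bd (H :\ z)) F1 (H :\ z) z y.
Proof.
move=> HK; have /setDP[/manyoutP[HS vH vm lo] _] := HK; have cH := Scvx HS.
rewrite -(center_nl HS vH vm) /nl -sum1_card natr_sum.
rewrite (eq_bigl (fun w => (w \in leaves H) && ((w != v) && ~~ e w v))); last first.
  by move=> w; apply/setIdP/andP.
rewrite big_mkcondr /=; apply: ler_sum => z zL.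
case: ifP => [/andP[zv nzv]|_]; last by apply: sumr_ge0 => y _; apply: F1_ge0.
have az : att H z != v by rewrite eq_sym -(leaf_att_eq zL vH).
have vU : v \in H :\ z by rewrite !inE eq_sym zv.
have oU : out (H :\ z) v = out H v.
  by rewrite (out_rem zL) // eq_sym (negPf az) addn0.
have o0 : (0 < out (H :\ z) v)%N.
  by rewrite oU (leq_trans _ lo) // ltnW // ltnW.
rewrite [leRHS](bigID (fun y => att (H :\ z) y == v)) /= -[leLHS]addr0.
apply: lerD; last by apply: sumr_ge0 => y _; apply: F1_ge0.
apply: le_trans (_ : \sum_(y in bd (H :\ z) | att (H :\ z) y == v) (out (H :\ z) v)%:R^-1 <= _).
  rewrite sumr_const.
  have -> : #|[pred y | (y \in bd (H :\ z)) & att (H :\ z) y == v]| = out (H :\ z) v.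
    by rewrite outE ?cvx_rem //; apply: eq_card => y; rewrite [RHS]in_set.
  by rewrite -[_ *+ out _ _]mulr_natl mulfV // gt_eqF // ltr0n.
apply: ler_sum => y /andP[yU ay]; rewrite /F1 (remK zL) HK (att_rem zL) az ay /=.
by rewrite (move_in HS vH vm zL az yU (eqP ay)).
Qed.

Lemma kept_ratio H z : H \in manyout :\: spill -> z \in leaves H -> att H z != v ->
  ((m + 2) * (#|bd (H :\ z)| - out (H :\ z) v) <= 3 * (l - m) * out (H :\ z) v)%N.
Proof.
move=> /setDP[HM HN] zL az; have [HS vH vm lo] := manyoutP HM; have cH := Scvx HS.
have vL := center_notleaf HS vH vm.
have zv : v != z by apply: contraNneq vL => ->.
have vU : v \in H :\ z by rewrite !inE zv.
have oU : out (H :\ z) v = out H v.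
  by rewrite (out_rem zL) // eq_sym (negPf az) addn0.
have : ~~ ((l - m + 2) * (out H v).+1 < 12 * ((m - 1) * (#|bd H| - out H v)))%N.
  by apply: contra HN => h; apply/setIdP.
rewrite -leqNgt oU => le1.
exact: arith_kept star (l_ge7 HS) (m_lt_l HS) lo le1 (card_bd_rem zL cH).
Qed.

(** Now the new leaf is one of at most [m + 2] leaves at [v], and the old one hangs elsewhere; by
    [kept_ratio], the weight for each new leaf is at most [3 * (l - m) / (m + 2)]. *)
Lemma centered_upper1 H : H \in ksets k.+1 ->
  \sum_(y in leaves H) \sum_(z in bd (H :\ y)) F1 (H :\ y) z y <=
  (if H \in centered then (3 * (l - m))%N%:R else 0).
Proof.
move=> Hk.
have key y z : y \in leaves H -> z \in bd (H :\ y) -> F1 (H :\ y) z y != 0 ->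
   [/\ H \in centered, (mv H v <= m + 2)%N, e y v,
       ((m + 2) * (#|bd (H :\ y)| - out (H :\ y) v) <= 3 * (l - m) * out (H :\ y) v)%N &
       v \in H :\ y /\ (0 < out (H :\ y) v)%N].
  move=> yL zU; rewrite /F1; case: ifP; last by rewrite eqxx.
  case/and4P => HK az /eqP ay yS _; have /setDP[HM _] := HK.
  have [HS vH vm lo] := manyoutP HM.
  have Uk := rem_ksets Hk yL; have cU := ksets_cvx Uk.
  have zL : z \in leaves (z |: (H :\ y)) by apply: ext_leaf.
  rewrite (remK yL) in yS.
  have vU : v \in H :\ y by rewrite -ay; case: (attP (rem_bd yL)).
  have zg : z \in goods (H :\ y) by apply/goodsP.
  have U2 := good_k Uk zg.
  have az' : att (z |: (H :\ y)) z != v by rewrite att_ext.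
  have := center_move_in (y := y) HS vH vm zL az'.
  have := kept_ratio HK zL az'.
  rewrite (extK zU) (remK yL) => kr /(_ (rem_bd yL) ay)[ce m2]; split=> //.
  - by apply/setIdP; split=> //; apply/setDP.
  - by rewrite (att_eq cU (rem_bd yL)) // ay.
  - by split=> //; rewrite (out_ext cU zU vU); move: lo l3; clear; lia.
have [/eqP ->|] := boolP (\sum_(y in leaves H) \sum_(z in bd (H :\ y)) F1 (H :\ y) z y == 0).
  by case: ifP.
rewrite psumr_neq0; last by move=> y _; apply: sumr_ge0 => z _; apply: F1_ge0.
case/hasP => y1 _ /andP[y1L]; rewrite lt0r => /andP[+ _].
rewrite psumr_neq0; last by move=> z _; apply: F1_ge0.
case/hasP => z1 _ /andP[z1U]; rewrite lt0r => /andP[F0 _].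
have [HC m2 _ _ _] := key _ _ y1L z1U F0; rewrite HC.
have m20 : 0 < (m + 2)%N%:R :> R by rewrite ltr0n addn2.
apply: le_trans (_ : (mv H v)%:R * ((3 * (l - m))%N%:R / (m + 2)%N%:R) <= _); last first.
  rewrite mulrCA -[leRHS]mulr1 ler_wpM2l ?ler0n // ler_pdivrMr // mul1r.
  by rewrite ler_nat.
rewrite /mv -sum1_card natr_sum mulr_suml.
rewrite [leRHS](eq_bigl (fun w => (w \in leaves H) && e w v)); last first.
  by move=> w; apply/setIdP/andP.
rewrite [leRHS]big_mkcondr /=; apply: ler_sum => y yL.
have [/eqP ->|] := boolP (\sum_(z in bd (H :\ y)) F1 (H :\ y) z y == 0).
  by case: ifP => // _; rewrite mul1r mulr_ge0 ?invr_ge0.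
rewrite psumr_neq0; last by move=> z _; apply: F1_ge0.
case/hasP => z2 _ /andP[z2U]; rewrite lt0r => /andP[F0' _].
have [_ _ -> kr [vU o0]] := key _ _ yL z2U F0'; rewrite mul1r.
have Uk := rem_ksets Hk yL; have cU := ksets_cvx Uk.
have o0' : 0 < (out (H :\ y) v)%:R :> R by rewrite ltr0n.
apply: le_trans (_ : \sum_(z in bd (H :\ y) | att (H :\ y) z != v) (out (H :\ y) v)%:R^-1 <= _).
  rewrite [leRHS]big_mkcondr /=; apply: ler_sum => z zU; rewrite /F1.
  by case: (att _ z == v); rewrite ?andbF //=; case: ifP; rewrite ?invr_ge0.
rewrite sumr_const; have -> : #|[pred z | (z \in bd (H :\ y)) & att (H :\ y) z != v]|
    = (#|bd (H :\ y)| - out (H :\ y) v)%N.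
  rewrite -(card_bd_elsewhere cU vU) addnK; apply: eq_card => z.
  by rewrite [RHS]in_set.
rewrite -[_ *+ (_ - _)]mulr_natl ler_pdivrMr // mulrAC ler_pdivlMr //.
by rewrite -!natrM ler_nat mulnC.
Qed.

Lemma card_kept : #|manyout :\: spill|%:R <= 3 * #|centered|%:R :> R.
Proof.
have [->|[H0 H0K]] := set_0Vmem (manyout :\: spill).
  by rewrite cards0 mulr_ge0 ?ler0n.
have j0 : 0 < (l - m)%N%:R :> R.
  by case/setDP: H0K => /manyoutP[/m_lt_l ml _ _ _] _; rewrite ltr0n subn_gt0.
rewrite -(ler_pM2r j0).
apply: le_trans (_ : \sum_(H in ksets k.+1) (if H \in centered then (3 * (l - m))%N%:R else 0) <= _).
  apply: le_trans (ler_sum _ centered_upper1); rewrite -(swap_sum _ _ k F1).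
  rewrite [leRHS](bigID (mem (manyout :\: spill))) /= -[leLHS]addr0; apply: lerD; last first.
    by apply: sumr_ge0 => H _; apply: sumr_ge0 => x _; apply: sumr_ge0 => w _; apply: F1_ge0.
  rewrite [leRHS](eq_bigl (mem (manyout :\: spill))).
    rewrite mulr_natl -sumr_const; apply: ler_sum => H; exact: kept_lower.
  move=> H; apply/andP/idP => [[]//|HP]; split=> //.
  by case/setDP: HP => /manyoutP[/(subsetP Sk)].
rewrite -big_mkcondr /= (eq_bigl (mem centered)); last first.
  move=> H; apply/andP/idP => [[]//|HC]; split=> //.
  by case/setIdP: HC => /setDP[].
by rewrite sumr_const -[_ *+ #|_|]mulr_natl natrM mulrA [_ * 3]mulrC.
Qed.

End Weights.

Lemma card_manyout : #|manyout| <= 15 * #|centered|.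
Proof.
have sM : spill \subset manyout by apply/subsetP => H /setIdP[].
rewrite -(cardsID spill manyout) (setIidPr sM).
have := card_spill rat; have := card_kept rat.
rewrite -!natrM !ler_nat; clear; lia.
Qed.

End FixCenter.

Lemma sum_centered : 1 < k -> \sum_(v : V) #|centered v| <= b.
Proof.
move=> k1; have -> : \sum_(v : V) #|centered v| =
    \sum_(X in ksets k.+1 :\: SS) \sum_(v : V) (center X v : nat).
  rewrite exchange_big /=; apply: eq_bigr => v _.
  rewrite -sum1_card big_mkcond [RHS]big_mkcond /=; apply: eq_bigr => X _.
  rewrite /centered in_set; case: (X \in _ :\: _) => //=.
rewrite /b -sum1_card; apply: leq_sum => X /setDP[Xk _].
have [[v cv]|] := altP (@existsP _ (center X)); last first.
  by rewrite negb_exists => /forallP h; rewrite big1 // => v _; rewrite (negPf (h v)).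
rewrite (bigD1 v) //= cv big1 // => v' v'v.
apply/eqP; rewrite eqb0; apply: contra v'v => cv'; apply/eqP.
have /ksetsP[cX Xc] := Xk; apply: center_uniq cX _ cv' cv.
by rewrite Xc.
Qed.

(** Copies with fewer than [l] outer neighbours at a centre number at most [16 * b], by Markov's
    inequality at rate [1 / 4]. The others are charged to centred subtrees, [15 * b] in total since
    centres are unique. *)
Lemma starlike_bound : #|[set H in SS | 2 * l <= #|bd H|]| <= 31 * b.
Proof.
set P := [set H in SS | _].
have [->|[X0 X0P]] := set_0Vmem P; first by rewrite cards0.
have k2 : 2 < k by case/setIdP: X0P => /Sk3.
pose Q := [set H in SS | (2 * l <= #|bd H|) && [exists v in H, (mv H v == m) && (out H v < l)]].
have PQ : P \subset Q :|: \bigcup_v manyout v.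
  apply/subsetP => H /setIdP[HS N2].
  have [|v vH vm] := @mx_attained H; first by rewrite -card_gt0 (Scard HS).
  rewrite (Sm HS) in vm; apply/setUP; have [lo|lo] := leqP l (out H v).
    by right; apply/bigcupP; exists v => //; apply/setIdP; rewrite HS vH vm eqxx.
  left; apply/setIdP; rewrite N2; split=> //; apply/exists_inP; exists v => //.
  by rewrite vm eqxx.
apply: leq_trans (subset_leq_card PQ) _; apply: leq_trans (leq_card_setU _ _) _.
have q16 : #|Q| <= 16 * b.
  have := @escapes_markov rat Q (1 / 4%:R)%R; rewrite -(ler_nat rat) => h.
  have := h _ _ _; set c : rat := #|Q|%:R%R; rewrite natrM; set c' : rat := b%:R%R.
  suff : (1 / 4%:R * c <= 4%:R * c')%R by lra.
  apply: h; [by apply/subsetP => H /setIdP[]|by []|].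
  move=> H /setIdP[HS /andP[N2 /exists_inP[v vH /andP[/eqP vm lo]]]].
  have := few_out_escapes HS vH vm lo N2; rewrite -(ler_nat rat) !natrM.
  by rewrite mul1r -mulrA ler_pdivrMl // [(l%:R * _)%R]mulrC.
have := sum_centered (ltnW k2); set s := (\sum_(v : V) _) => sb.
have : #|\bigcup_v manyout v| <= 15 * s.
  rewrite /s big_distrr /=.
  apply: leq_trans (_ : \sum_v #|manyout v| <= _); last by apply: leq_sum => v _; apply: card_manyout.
  rewrite -(big_mkcond xpredT); elim/big_rec2: _ => [|v n A _ le]; first by rewrite cards0.
  by apply: leq_trans (leq_card_setU _ _) _; rewrite leq_add2l.
move: q16 sb; clear; lia.
Qed.

End Starlike.

(** * Copies that are not starlike: wide boundaries are rare *)

Section Nonstarlike.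
Variable C : nat.
Hypotheses (nstar : 20 * m < 17 * l) (C0 : 0 < C).

(* In [y |: U], the leaf [y] hangs at a vertex with few outer neighbours
   compared with its number of leaves. *)
Definition atypical U y :=
  C * l * out U (att U y) < #|bd U| * mv (y |: U) (att U y).
(** Guarantees that [H :\ x] keeps at least half as many boundary vertices as [H]. *)
Definition undominated H x := 2 * out H x <= #|bd H|.

Lemma mv_ext_le U y v : cvx U -> 1 < #|U| -> y \in bd U -> mv (y |: U) v <= (mv U v).+1.
Proof.
move=> cU U2 yU; apply: (@card_sub_setU1 _ _ y); apply/subsetP => u /setIdP[uL uv].
apply/setU1P; have [->|uy] := eqVneq u y; [by left|right]; apply/setIdP; split=> //.
exact: leaves_ext_sub cU U2 yU uL uy.
Qed.

(** The attachment vertices of good extensions share one value of [ds U], so [card_ds_level] leaves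
    at most [l + 1] of them. An atypical one has at most [#|bd U| * (mv U v + 1) / (C * l)] outer
    neighbours, and the numbers [mv U v + 1] add up to at most [l + (l + 1) <= 3 * l]. *)
Lemma card_atypical U : U \in ksets k ->
  C * #|[set y in goods U | atypical U y]| <= 3 * #|bd U|.
Proof.
move=> Uk; set A := [set y in _ | _]; have cU := ksets_cvx Uk.
have [->|[y0 y0A]] := set_0Vmem A; first by rewrite cards0 muln0.
have y0G : y0 \in goods U by case/setIdP: y0A.
have U2 := good_k Uk y0G; have lU := good_leaves Uk y0G.
pose P := att U @: A.
have PU : P \subset U.
  by apply/subsetP => _ /imsetP[y /setIdP[/goodsP[yU _] _] ->]; case: (attP yU).
have cP : #|P| <= l.+1.
  apply: leq_trans (_ : #|leaves U|.+1 <= _); last by rewrite ltnS.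
  apply: leq_trans (card_ds_level (ds U (att U y0)) cU U2); apply: subset_leq_card.
  apply/subsetP => _ /imsetP[y yA ->]; have /setIdP[yG _] := yA.
  apply/setIdP; split; first by apply: (subsetP PU); apply: imset_f.
  by apply/eqP; apply: good_ds.
have le1 : #|A| <= \sum_(v in P) out U v.
  rewrite sum_out //; apply: subset_leq_card; apply/subsetP => y yA.
  by have /setIdP[/goodsP[yU _] _] := yA; apply/setIdP; split=> //; apply: imset_f.
have le2 : C * l * (\sum_(v in P) out U v) <= #|bd U| * \sum_(v in P) (mv U v).+1.
  rewrite !big_distrr /=; apply: leq_sum => _ /imsetP[y /setIdP[/goodsP[yU _] ay] ->].
  by apply: leq_trans (ltnW ay) _; rewrite leq_mul2l mv_ext_le ?orbT.
have le3 : \sum_(v in P) (mv U v).+1 <= 3 * l.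
  under eq_bigr => v _ do rewrite -addn1.
  rewrite big_split /= sum_mv // sum_nat_const muln1.
  have : #|[set x in leaves U | att U x \in P]| <= l.
    by apply: leq_trans lU; apply: subset_leq_card; apply/subsetP => x /setIdP[].
  by move: cP l3; clear; lia.
have l0 : 0 < l by apply: leq_trans l3.
rewrite -(leq_pmul2r l0) mulnAC; apply: leq_trans (_ : C * l * \sum_(v in P) out U v <= _).
  by rewrite leq_mul2l le1 orbT.
by apply: leq_trans le2 _; rewrite mulnAC [3 * l * _]mulnC leq_mul2l le3 orbT.
Qed.

Section Cluster.
Variable H : {set V}.
Hypotheses (HS : H \in SS) (Hbig : 4 * C * l <= #|bd H|)
  (Hesc : 320 * C * escapes H <= #|bd H| * l).
Let N := #|bd H|.
Let cH := Scvx HS.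
Let H3 : 2 < #|H|.
Proof. by rewrite (Scard HS) ltnS ltnW // (Sk3 HS). Qed.

Definition regular := [set x in leaves H | undominated H x && ~~ atypical (H :\ x) x].
Definition irregular := [set x in leaves H | undominated H x && atypical (H :\ x) x].
Definition dominated := [set x in leaves H | ~~ undominated H x].

Lemma card_regular : #|regular| + #|irregular| + #|dominated| = l.
Proof.
rewrite -(Sl HS) (card_setId_compl (leaves H) (undominated H)); congr (_ + _).
rewrite [RHS](card_setId_split _ _ (fun x => atypical (H :\ x) x)).
exact: addnC.
Qed.

(** Outer neighbours of two leaves are disjoint, so only one leaf can have more than half of the
    boundary. *)
Lemma card_dominated : #|dominated| <= 1.
Proof.
rewrite leqNgt; apply/negP => /card_gt1P[x [y [xD yD xy]]].
have /setIdP[xL nx] := xD; have /setIdP[yL ny] := yD.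
have := @sum_out_le H [set x; y] cH.
rewrite subUset !sub1set (leaf_in xL) (leaf_in yL) => /(_ isT).
rewrite big_setU1 ?inE //= big_set1; move: nx ny; rewrite /undominated; clear; lia.
Qed.

Lemma att_notleaf x y : x \in leaves H -> y \in leaves H -> att H x != y.
Proof.
move=> xL yL; apply: contraTneq yL => <-; exact: leaf_att_notleaf.
Qed.

(** Passing from [H :\ x] to [H] costs a factor 2 for the boundary and another 2 for
    [out + 1 <= 2 * out]; the latter holds because a boundary of size [4 * C * l] forces [out] to be
    positive. *)
Lemma regular_out x : x \in regular ->
  N * mv H (att H x) <= 4 * C * l * out H (att H x).
Proof.
case/setIdP => xL /andP[ux]; rewrite /atypical -leqNgt (att_rem xL) (remK xL).
have [aH xa] := leaf_att xL.
have mv1 : 0 < mv H (att H x) by apply/card_gt0P; exists x; apply/setIdP.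
rewrite (out_rem xL cH (att_in_rem xL)) eqxx addn1.
have := card_bd_rem xL cH; rewrite /undominated -/N in ux *.
have NC : 4 * C * l <= N by [].
have Cl0 : 0 < C * l by rewrite muln_gt0 C0 (leq_trans _ l3).
rewrite -mulnA in NC *; move: (C * l) Cl0 NC mv1 ux => c.
move: (mv H _) (out H _) (out H _) #|bd (H :\ x)| => mv o ox NU.
clear => c0 Nc mv1 ux eN le.
have NU2 : N <= 2 * NU by lia.
have le2 : N * mv <= 2 * (c * o.+1).
  by apply: leq_trans (_ : 2 * (NU * mv) <= _); [rewrite mulnA leq_mul2r NU2 orbT|rewrite leq_mul2l le].
have o1 : 0 < o.
  have : 4 * c <= 2 * (c * o.+1).
    by apply: leq_trans le2; apply: leq_trans Nc _; rewrite leq_pmulr.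
  by case: o {le le2} => // ; rewrite muln1; lia.
by apply: leq_trans le2 _; nia.
Qed.

(** Moving [x] to an outer neighbour of [v] then changes the squared degrees; the [+ 1] is the
    degree lost where [x] was. *)
Definition clash x v := (att H x != v) && (deg H v + 1 != deg H (att H x)).

Lemma clash_escapes (P : {set V}) : P \subset H -> [disjoint P & leaves H] ->
  \sum_(x in leaves H) \sum_(v in P | clash x v) out H v <= escapes H.
Proof.
move=> PH PL; apply: leq_sum => x xL.
pose Q := [set v in P | clash x v].
have QH : Q \subset H by apply: subset_trans PH; apply/subsetP => v /setIdP[].
rewrite (eq_bigl (mem Q)); last by move=> v; apply/andP/setIdP.
rewrite sum_out //; apply: subset_leq_card; apply/subsetP => y /setIdP[yH].
case/setIdP => aP /andP[ne1 ne2].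
have ax : att H y != x.
  by apply: contraTneq aP => ->; rewrite (disjointFl PL xL).
have [yR ay] := bd_rem_keep cH xL yH ax.
apply/setIP; split=> //; apply/setIdP; split=> //.
have [aH _] := attP yH; have aR : att H y \in H :\ x by rewrite !inE ax.
apply: swap_bad => //; rewrite ay; apply: contraNneq ne2 => dd.
rewrite (deg_rem xL cH (att_in_rem xL)) eqxx (deg_rem xL cH aR) dd.
by rewrite [att H y == _]eq_sym (negPf ne1) addn0.
Qed.

(** By [regular_out], the vertices carrying regular leaves have outer neighbours in proportion to
    their leaves, so clashing pairs of leaves turn into escapes. *)
Lemma regular_clash :
  N * \sum_(x in regular) #|[set y in regular | clash x (att H y)]| <=
  4 * C * l * escapes H.
Proof.
pose P := att H @: regular.
have PH : P \subset H.
  by apply/subsetP => _ /imsetP[x /setIdP[xL _] ->]; case: (leaf_att xL).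
have PL : [disjoint P & leaves H].
  apply/pred0Pn => -[_ /andP[/imsetP[x /setIdP[xL _] ->]]] /=.
  by rewrite (negPf (leaf_att_notleaf xL cH H3)).
apply: leq_trans (_ : 4 * C * l * (\sum_(x in leaves H) \sum_(v in P | clash x v) out H v) <= _);
  last by rewrite leq_mul2l clash_escapes ?orbT.
rewrite !big_distrr /= [leqRHS](bigID (mem regular)) /=.
apply: leq_trans (leq_addr _ _).
rewrite [leqRHS](eq_bigl (mem regular)); last first.
  by move=> x; apply/andP/idP => [[]//|h]; split=> //; case/setIdP: h.
apply: leq_sum => x xR; rewrite big_distrr /=.
pose Q := [set v in P | clash x v].
have QH : Q \subset H by apply: subset_trans PH; apply/subsetP => v /setIdP[].
apply: leq_trans (_ : N * \sum_(v in Q) mv H v <= _).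
  rewrite leq_mul2l sum_mv //; apply/orP; right; apply: subset_leq_card.
  apply/subsetP => y /setIdP[yR cl]; have /setIdP[yL _] := yR.
  by apply/setIdP; split=> //; apply/setIdP; split=> //; apply: imset_f.
rewrite big_distrr /= [leqRHS](eq_bigl (mem Q)); last first.
  by move=> v; apply/andP/setIdP.
by apply: leq_sum => v /setIdP[/imsetP[y yR ->] _]; apply: regular_out.
Qed.

(** Of two regular leaves at different vertices, one clashes with the vertex of the other, because
    the degrees cannot each exceed the other by one. The leaf with the fewest regular leaves
    elsewhere does the job; the 320 of [Hesc] is [40 * 2 * 4]. *)
Lemma regular_cluster : 0 < #|regular| -> exists2 x, x \in regular &
  40 * (#|regular| * #|[set y in regular | att H y != att H x]|) <= l * l.
Proof.
move=> /card_gt0P[x0 x0R].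
have [x xR xmin] := @arg_minnP _ x0 (mem regular)
  (fun x => #|[set y in regular | att H y != att H x]|) x0R.
exists x => //; set g := #|[set y in regular | _]| in xmin *.
have le1 : #|regular| * g <= \sum_(x in regular) #|[set y in regular | att H y != att H x]|.
  by rewrite -sum_nat_const; apply: leq_sum => y yR; apply: xmin.
pose s := \sum_(x in regular) #|[set y in regular | clash x (att H y)]|.
have le2 : \sum_(x in regular) #|[set y in regular | att H y != att H x]| <= 2 * s.
  have -> : 2 * s = s + \sum_(x in regular) #|[set y in regular | clash y (att H x)]|.
    rewrite mul2n -addnn; congr (_ + _); rewrite /s.
    transitivity (\sum_(x in regular) \sum_(y in regular) (clash x (att H y) : nat)).
      apply: eq_bigr => y _; rewrite -sum1_card big_mkcond [RHS]big_mkcond /=.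
      by apply: eq_bigr => z _; rewrite in_set; case: (z \in regular) => //=; case: clash.
    rewrite exchange_big /=; apply: eq_bigr => y _.
    rewrite -sum1_card big_mkcond [RHS]big_mkcond /=.
    by apply: eq_bigr => z _; rewrite in_set; case: (z \in regular) => //=; case: clash.
  rewrite -big_split /=; apply: leq_sum => y yR; apply: leq_trans (leq_card_setU _ _).
  apply: subset_leq_card; apply/subsetP => z /setIdP[zR ne]; apply/setUP.
  have [eq1|ne1] := eqVneq (deg H (att H z) + 1) (deg H (att H y)).
    right; apply/setIdP; split=> //; rewrite /clash ne -eq1; apply/eqP; clear; lia.
  by left; apply/setIdP; split=> //; rewrite /clash eq_sym ne.
have N0 : 0 < N by apply: Sbd.
have := regular_clash; rewrite -/s => le3.
rewrite -(leq_pmul2l N0); apply: leq_trans (_ : N * (40 * (2 * s)) <= _).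
  by rewrite leq_mul2l leq_mul2l (leq_trans le1 le2) !orbT.
have -> : N * (40 * (2 * s)) = 80 * (N * s).
  by rewrite mulnCA [in LHS](mulnCA N) mulnA.
apply: leq_trans (_ : 80 * (4 * C * l * escapes H) <= _); first by rewrite leq_mul2l le3.
have -> : 80 * (4 * C * l * escapes H) = 320 * C * escapes H * l.
  by rewrite -[320]/(80 * 4) -!mulnA; congr (_ * (_ * (_ * _))); rewrite mulnC.
by rewrite mulnA leq_mul2r Hesc orbT.
Qed.

(** Otherwise most leaves cluster at one vertex [v]. Without a dominated leaf the share is
    [9 / 10 - 1 / 20 = 17 / 20], against [nstar]. A dominated leaf [x0] has over half of the
    boundary next to it, and moving the clustered leaves there gives too many escapes. *)
Lemma irregular_many : l < 10 * #|irregular|.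
Proof.
rewrite ltnNge; apply/negP => le1; have c1 := card_regular; have d1 := card_dominated.
have R0 : 0 < #|regular| by move: l3 le1 c1 d1; clear; lia.
have [x xR] := regular_cluster R0; have /setIdP[xL _] := xR.
have [aH _] := leaf_att xL; set v := att H x in aH *.
set gc := #|[set y in regular | _]| => le2; pose g := #|[set y in regular | att H y == v]|.
have eg : g + gc = #|regular|.
  exact/esym/(card_setId_compl regular (fun y => att H y == v)).
have gm : g <= mv H v.
  rewrite mvE //; apply: subset_leq_card; apply/subsetP => y /setIdP[/setIdP[yL _] ay].
  exact/setIdP.
have R2 : l <= 2 * #|regular| by move: l3 le1 c1 d1; clear; lia.
have le3 : 20 * gc <= l.
  have l0 : 0 < l by apply: leq_trans l3.
  rewrite -(leq_pmul2l l0); apply: leq_trans le2.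
  by rewrite mulnCA -[40]/(20 * 2) -mulnA leq_mul2l /= mulnA leq_mul2r R2 orbT.
have [D0|[x0 x0D]] := set_0Vmem dominated.
  have := leq_mv_mx aH; rewrite (Sm HS); move: nstar le1 c1 gm eg le3.
  by rewrite D0 cards0; clear; lia.
have /setIdP[x0L nu] := x0D.
have x0H := leaf_in x0L.
have esc : g * out H x0 <= escapes H.
  pose G := [set y in regular | att H y == v].
  rewrite -sum_nat_const /escapes [leqRHS](bigID (mem G)) /=.
  apply: leq_trans (leq_addr _ _); rewrite [leqRHS](eq_bigl (mem G)); last first.
    by move=> y; apply/andP/idP => [[]//|h]; split=> //; case/setIdP: h => /setIdP[].
  apply: leq_sum => z /setIdP[zR /eqP az]; have /setIdP[zL /andP[zu _]] := zR.
  have zx : x0 != z by apply: contraNneq nu => ->.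
  rewrite outE //; apply: subset_leq_card; apply/subsetP => y /setIdP[yH /eqP ay].
  have yz : att H y != z by rewrite ay.
  have [yR ayR] := bd_rem_keep cH zL yH yz.
  apply/setIP; split=> //; apply/setIdP; split=> //.
  have xz : x0 \in H :\ z by rewrite !inE zx.
  apply: swap_bad => //; rewrite ayR ay.
  have := deg_rem zL cH (att_in_rem zL); have := deg_rem zL cH xz.
  rewrite eqxx eq_sym (negPf (att_notleaf zL x0L)) az.
  have /leavesP[_ ->] := x0L; have := mv_lt_deg cH (Sn HS) aH.
  move: l3 le1 c1 d1 gm eg le3; clear => h1 h2 h3 h4 h5 h6 h7 h8 h9 h10.
  by apply/eqP; lia.
have g2 : l <= 2 * g by move: l3 le1 c1 d1 eg le3; clear; lia.
have N0 : 0 < N by apply: Sbd.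
have : 320 * escapes H <= N * l.
  by apply: leq_trans Hesc; rewrite -mulnA leq_mul2l leq_pmull ?orbT.
have : N * g <= 2 * escapes H.
  apply: leq_trans (_ : 2 * (g * out H x0) <= _); last by rewrite leq_mul2l esc.
  by rewrite mulnCA mulnC leq_mul2l ltnW ?orbT // ltnNge.
have : N * l <= 2 * (N * g) by rewrite mulnCA leq_mul2l g2 orbT.
have : 0 < N * l by rewrite muln_gt0 N0 (leq_trans _ l3).
clear; lia.
Qed.
End Cluster.

Definition wide j := [set H in SS | j * l <= #|bd H|].

(** Sum [card_atypical] over the [U] left by an undominated leaf, whose boundary exceeds [K * l].
    The good part of [#|bd U|] counts copies in [wide K] with one of their [l] leaves; the bad part
    is bounded by [sum_bads]. *)
Lemma sum_irregular K (P : {set {set V}}) : P \subset wide (2 * K) ->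
  C * \sum_(H in P) #|irregular H| <= 3 * (l * #|wide K| + l.+1 * b).
Proof.
move=> PW.
pose f U y : nat := [&& y |: U \in SS, K * l < #|bd U| & atypical U y].
have le1 : \sum_(H in P) #|irregular H| <=
    \sum_(U in ksets k | K * l < #|bd U|) #|[set y in goods U | atypical U y]|.
  apply: leq_trans (_ : \sum_(H in ksets k.+1) \sum_(x in leaves H) f (H :\ x) x <= _).
    rewrite [leqRHS](bigID (mem P)) /=; apply: leq_trans (leq_addr _ _).
    rewrite [leqRHS](eq_bigl (mem P)); last first.
      move=> H; apply/andP/idP => [[]//|h]; split=> //.
      by case/(subsetP PW)/setIdP: h => /(subsetP Sk).
    apply: leq_sum => H /(subsetP PW)/setIdP[HS big].
    rewrite -sum1_card /irregular.
    rewrite (eq_bigl (fun x => (x \in leaves H) && (undominated H x && atypical (H :\ x) x)));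
      last by move=> x; apply/setIdP/andP.
    rewrite big_mkcondr /=; apply: leq_sum => x xL; case: ifP => // /andP[ux ax].
    rewrite /f (remK xL) HS ax andbT /=.
    have := card_bd_rem xL (Scvx HS); move: ux big; rewrite /undominated -mulnA.
    by move: (K * l) => c; clear => ux big eN; have -> : c < #|bd (H :\ x)| by lia.
  rewrite (edge_sum _ _ _ f) [leqRHS]big_mkcondr /=; apply: leq_sum => U Uk.
  case: ifP => KU; last by rewrite big1 // => y _; rewrite /f KU andbF.
  rewrite -[leqRHS]sum1_card.
  rewrite [leqRHS](eq_bigl (fun y => (y \in bd U) && ((y |: U \in SS) && atypical U y))); last first.
    by move=> y; apply/setIdP/andP => [[/goodsP[-> ->] ->]|[y1 /andP[y2 y3]]]; split=> //; apply/goodsP.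
  rewrite [leqRHS]big_mkcondr /=; apply: leq_sum => y _; rewrite /f KU /=.
  by case: (_ && _).
have le2 : C * \sum_(U in ksets k | K * l < #|bd U|) #|[set y in goods U | atypical U y]| <=
    \sum_(U in ksets k | (K * l < #|bd U|) && (0 < #|goods U|)) 3 * #|bd U|.
  rewrite big_distrr /= [leqLHS]big_mkcondr [leqRHS]big_mkcondr /=.
  apply: leq_sum => U Uk; case: ifP => KU //=; case: posnP => g0; last exact: card_atypical.
  rewrite (_ : #|_| = 0) ?muln0 //; apply/eqP; rewrite -leqn0 -g0.
  by apply: subset_leq_card; apply/subsetP => y /setIdP[].
apply: leq_trans (leq_trans _ le2) _; first by rewrite leq_mul2l le1 orbT.
rewrite -big_distrr /= leq_mul2l /=.
under eq_bigr => U _ do rewrite -goods_bads.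
rewrite big_split /=; apply: leq_add; last first.
  apply: leq_trans sum_bads; rewrite [leqRHS]big_mkcondr [leqLHS]big_mkcondr /=.
  by apply: leq_sum => U _; case: (K * l < _) => //=.
apply: leq_trans (_ : \sum_(U in ksets k) \sum_(y in bd U)
    ((y |: U \in SS) && (K * l < #|bd U|)) <= _).
  rewrite [leqLHS]big_mkcondr; apply: leq_sum => U Uk; case: ifP => // /andP[-> _].
  rewrite -sum1_card (eq_bigl (fun y => (y \in bd U) && (y |: U \in SS))); last first.
    by move=> y; apply/goodsP/andP.
  by rewrite big_mkcondr /=; apply: leq_sum => y _; case: ifP.
rewrite -(edge_sum _ _ _ (fun U y => ((y |: U \in SS) && (K * l < #|bd U|) : nat))) /=.
rewrite [l * _]mulnC -sum_nat_const (bigID (mem (wide K))) /=.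
rewrite [X in _ + X <= _]big1 ?addn0; last first.
  move=> H /andP[Hk HW]; rewrite big1 // => x xL; rewrite (remK xL).
  apply/eqP; rewrite eqb0; apply: contra HW => /andP[HS KN]; apply/setIdP; split=> //.
  by have := card_bd_rem xL (Scvx HS); move: KN; move: (K * l) => c; clear; lia.
rewrite (eq_bigl (mem (wide K))); last first.
  move=> H; apply/andP/idP => [[]//|h]; split=> //.
  by case/setIdP: h => /(subsetP Sk).
apply: leq_sum => H /setIdP[HS _]; rewrite -(Sl HS) -sum1_card.
by apply: leq_sum => x _; case: (_ && _).
Qed.

(** Copies with many escapes number at most [4 * 320 * C * b] by Markov's inequality; the others
    have more than [l / 10] irregular leaves each, which [sum_irregular] allows only rarely. *)
Lemma wide_step K : 2 * C <= K ->
  C * #|wide (2 * K)| <= 30 * #|wide K| + 60 * b + 1280 * C * C * b.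
Proof.
move=> CK; pose P := [set H in wide (2 * K) | 320 * C * escapes H <= #|bd H| * l].
pose E := [set H in SS | #|bd H| * l < 320 * C * escapes H].
have PE : wide (2 * K) \subset P :|: E.
  apply/subsetP => H HW; apply/setUP; have /setIdP[HS _] := HW.
  by have [le|le] := leqP (320 * C * escapes H) (#|bd H| * l); [left|right]; apply/setIdP.
have leE : #|E| <= 1280 * C * b.
  pose c : rat := ((320 * C)%:R^-1)%R.
  have C0' : (0 < (320 * C)%:R :> rat)%R by rewrite ltr0n muln_gt0.
  have := @escapes_markov rat E c; rewrite -(ler_nat rat) => h.
  have : (c * #|E|%:R <= 4 * b%:R)%R.
    apply: h; [by apply/subsetP => H /setIdP[]|by rewrite invr_ge0 ltW|].
    move=> H /setIdP[HS le]; rewrite -mulrA mulrC ler_pdivrMr //.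
    by rewrite -!natrM ler_nat [escapes H * _]mulnC ltnW.
  rewrite mulrC ler_pdivrMr // => /le_trans; apply.
  by rewrite -!natrM ler_nat; move: b C; clear => b C; lia.
have leP : C * #|P| <= 30 * #|wide K| + 60 * b.
  have l0 : 0 < l by apply: leq_trans l3.
  have PW : P \subset wide (2 * K) by apply/subsetP => H /setIdP[].
  have := sum_irregular PW; have : l * #|P| <= 10 * \sum_(H in P) #|irregular H|.
    rewrite mulnC -sum_nat_const big_distrr /=; apply: leq_sum => H /setIdP[].
    case/setIdP => HS big esc; apply: ltnW; apply: irregular_many => //.
    by apply: leq_trans big; rewrite leq_mul2r; move: CK; clear; lia.
  set s := \sum_(H in P) _ => le1 le2; rewrite -(leq_pmul2l l0).
  apply: leq_trans (_ : 10 * (C * s) <= _); first by rewrite mulnCA [10 * _]mulnCA leq_mul2l le1 orbT.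
  apply: leq_trans (_ : 10 * (3 * (l * #|wide K| + l.+1 * b)) <= _); first by rewrite leq_mul2l le2.
  by move: l0; move: #|wide K| => c; clear; nia.
apply: leq_trans (_ : C * (#|P| + #|E|) <= _).
  by rewrite leq_mul2l (leq_trans (subset_leq_card PE) (leq_card_setU _ _)) orbT.
rewrite mulnDr leq_add // -mulnA -mulnA mulnCA leq_mul2l.
by rewrite mulnA leE orbT.
Qed.
End Nonstarlike.

(** * Moving leaves towards a root *)

Section Rooted.
Variable r : V.

Definition top X := odflt r [pick t in X | [forall u in X, d r t <= d r u]].
Definition up X := step r (top X).
Definition next X := up X |: X.

Lemma topP X : X != set0 -> top X \in X /\ {in X, forall u, d r (top X) <= d r u}.
Proof.
move=> /set0Pn[u0 u0X]; rewrite /top; case: pickP => [t /andP[tX /forall_inP h]|no] //.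
have [t tX tm] := @arg_minnP _ u0 (mem X) (d r) u0X.
by have := no t; rewrite (tX : t \in X) (introT forall_inP).
Qed.

(** If the path from [t] ever came nearer to [r], the vertex before that step would be [t] itself or
    have two neighbours nearer to [r]. *)
Lemma min_dist X t w : cvx X -> t \in X -> {in X, forall u, d r t <= d r u} ->
  w \in X -> d r w = d r t + d t w.
Proof.
move=> cX tX tm; have [n] := ubnP (d t w); elim: n => // n IH in w *.
rewrite ltnS => dn wX; have [->|wt] := eqVneq w t; first by rewrite distxx addn0.
have [e1 d1] := stepP T wt; have cX' := cvxP _ _ cX t w tX wX wt.
have IHc := IH _ (leq_trans (eq_leq (esym d1)) dn) cX'.
set c := step t w in e1 d1 cX' IHc.
have [->|dc] := dist_edge r e1; first by rewrite IHc d1 addnS.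
have [ct|ct] := eqVneq c t; first by have := tm w wX; rewrite -ct dc ltnn.
have [e2 d2] := stepP T ct; exfalso.
have ecw : e c w by rewrite edge_sym.
have s1 := stepE ecw dc; have : step r c = step t c.
  apply: stepE => //; have := dist_triangle T r t (step t c).
  by have [|] := dist_edge r e2; move: d2 IHc; clear; lia.
by rewrite s1 => h; move: d1; rewrite d2 -h; clear; lia.
Qed.

Lemma top_eq X t : cvx X -> t \in X -> {in X, forall u, d r t <= d r u} -> top X = t.
Proof.
move=> cX tX tm; have [|sX sm] := @topP X; first by apply/set0Pn; exists t.
have := min_dist cX tX tm sX; have := sm t tX => le eq1; apply/esym/eqP.
by rewrite -(dist_eq0 T); move: eq1 le; clear; lia.
Qed.

Section Up.
Variable U : {set V}.
Hypotheses (cU : cvx U) (U0 : U != set0) (rU : r \notin U).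

Lemma up_edge : e (top U) (up U) /\ d r (top U) = (d r (up U)).+1.
Proof.
have [tU _] := topP U0; apply: stepP; by apply: contraNneq rU => <-.
Qed.

Lemma up_bd : up U \in bd U.
Proof.
have [tU tm] := topP U0; have [e1 d1] := up_edge.
apply/bdP; split; last by exists (top U); rewrite // edge_sym.
by apply/negP => /tm; rewrite d1 ltnn.
Qed.

Lemma att_up : att U (up U) = top U.
Proof.
have [tU _] := topP U0; have [e1 _] := up_edge.
by apply/esym/eqP; rewrite -(att_eq cU up_bd) // edge_sym.
Qed.

Lemma dist_up w : w \in U -> d (up U) w = (d (top U) w).+1.
Proof. by move=> wU; rewrite (dist_att cU up_bd) // att_up. Qed.

Lemma top_next : top (next U) = up U.
Proof.
have [tU tm] := topP U0; have [e1 d1] := up_edge.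
apply: top_eq; [exact: cvx_ext cU up_bd|exact: setU11|].
by move=> u /setU1P[->//|/tm]; rewrite d1; apply: ltnW.
Qed.

Lemma ds_up : ds U (up U) = ds U (top U) + #|U|.
Proof. by rewrite (ds_att cU up_bd) att_up. Qed.
End Up.

(** Deleting the top of [next U] gives back [U]. *)
Lemma next_inj : {in [set U in ksets k | r \notin U] &, injective next}.
Proof.
move=> U U' /setIdP[/ksetsP[cU cardU] rU] /setIdP[/ksetsP[cU' cardU'] rU'] eN.
have [U0|U0] := eqVneq U set0.
  by move: cardU'; rewrite -cardU U0 cards0 => /eqP; rewrite cards_eq0 => /eqP.
have U0' : U' != set0 by rewrite -card_gt0 cardU' -cardU card_gt0.
have eu : up U = up U' by rewrite -(top_next cU U0 rU) eN top_next.
by rewrite -(extK (up_bd U0 rU)) -/(next U) eN eu (extK (up_bd U0' rU')).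
Qed.

Definition SR := [set H in SS | r \notin H].
Let b' := #|ksets k.+1 :\: SR|.
Implicit Types (P Q : {set {set V}}).

(** [P] is the exceptional set of the level below: a move must also avoid it for further moves to be
    available. *)
Definition stray P H := [set x in leaves H | next (H :\ x) \notin SR :\: P].
Definition rough K P := [set H in SR | (K * l <= #|bd H|) || (l < 20 * #|stray P H|)].

Lemma SRP H : H \in SR -> H \in SS /\ r \notin H.
Proof. by case/setIdP. Qed.

(** A stray leaf [x] of [H] gives [U = H :\ x] with [next U] among at most [b' + #|P|] sets, and
    [next] is injective. Each such [U] comes from at most [K * l] copies with small boundary, and
    the [l] cancels against the [l / 20] stray leaves. *)
Lemma card_rough K P : #|rough K P| <= #|wide K| + 20 * (K * (b' + #|P|)).
Proof.
have [->|[H0 /setIdP[/SRP[/Sk3 k2 _] _]]] := set_0Vmem (rough K P); first by rewrite cards0.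
pose Q := [set H in SR | (#|bd H| < K * l) && (l < 20 * #|stray P H|)].
have RQ : rough K P \subset wide K :|: Q.
  apply/subsetP => H /setIdP[HR h]; apply/setUP.
  have [HS _] := SRP HR; have [le|lt] := leqP (K * l) #|bd H|; [left|right].
    exact/setIdP.
  by apply/setIdP; split=> //; rewrite lt; move: h; rewrite leqNgt lt.
apply: leq_trans (subset_leq_card RQ) _; apply: leq_trans (leq_card_setU _ _) _.
rewrite leq_add2l.
have l0 : 0 < l by apply: leq_trans l3.
rewrite -(leq_pmul2r l0) -sum_nat_const.
apply: leq_trans (_ : \sum_(H in Q) 20 * #|stray P H| <= _).
  by apply: leq_sum => H /setIdP[_ /andP[_ /ltnW]].
rewrite -big_distrr /= -mulnA leq_mul2l /=.
pose f U y : nat := (y |: U \in Q) && (next U \notin SR :\: P).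
pose UU := [set U in ksets k | r \notin U & next U \notin SR :\: P].
have cUU : #|UU| <= b' + #|P|.
  have inj : {in UU &, injective next}.
    move=> U U' /setIdP[Uk /andP[Ur _]] /setIdP[Uk' /andP[Ur' _]].
    by apply: next_inj; apply/setIdP.
  rewrite -(card_in_imset inj).
  apply: leq_trans (_ : #|(ksets k.+1 :\: SR) :|: P| <= _); last exact: leq_card_setU.
  apply: subset_leq_card; apply/subsetP => _ /imsetP[U /setIdP[Uk /andP[rU nU]] ->].
  have U0 : U != set0 by rewrite -card_gt0 (ksets_card Uk) (ltn_trans _ k2).
  have nk : next U \in ksets k.+1 by apply: ext_ksets (up_bd U0 rU).
  apply/setUP; have [nP|nP] := boolP (next U \in P); [by right|left].
  by apply/setDP; split=> //; apply: contra nU => nR; apply/setDP.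
apply: leq_trans (_ : \sum_(H in ksets k.+1) \sum_(x in leaves H) f (H :\ x) x <= _).
  rewrite [leqRHS](bigID (mem Q)) /=; apply: leq_trans (leq_addr _ _).
  rewrite [leqRHS](eq_bigl (mem Q)); last first.
    move=> H; apply/andP/idP => [[]//|h]; split=> //.
    by case/setIdP: h => /SRP[/(subsetP Sk)].
  apply: leq_sum => H HQ; rewrite -sum1_card.
  rewrite (eq_bigl (fun x => (x \in leaves H) && (next (H :\ x) \notin SR :\: P)));
    last by move=> x; apply/setIdP/andP.
  rewrite big_mkcondr /=; apply: leq_sum => x xL; case: ifP => // nx.
  by rewrite /f (remK xL) HQ nx.
rewrite (edge_sum _ _ _ f).
apply: leq_trans (_ : \sum_(U in UU) K * l <= _); last first.
  by rewrite sum_nat_const mulnC mulnAC leq_mul2r leq_mul2l cUU !orbT.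
rewrite [leqRHS](eq_bigl (fun U => (U \in ksets k) && ((r \notin U) && (next U \notin SR :\: P))));
  last by move=> U; apply/setIdP/andP.
rewrite [leqRHS]big_mkcondr /=; apply: leq_sum => U Uk.
have [->//|] := posnP (\sum_(y in bd U) f U y).
rewrite lt0n sum_nat_eq0 negb_forall_in => /exists_inP[y yU].
rewrite eqb0 negbK => /andP[/setIdP[/SRP[yS ry] /andP[small _]] nU].
have -> : r \notin U by apply: contra ry; apply: mem_ext.
rewrite nU /=; apply: leq_trans (_ : \sum_(y in bd U) 1 <= _).
  by apply: leq_sum => z _; rewrite /f leq_b1.
rewrite sum1_card; have := card_bd_ext (ksets_cvx Uk) yU.
by move: small; move: (K * l) => c; clear; lia.
Qed.

Section Step.
Variables (H : {set V}) (x : V).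
Hypotheses (HR : H \in SR) (xL : x \in leaves H) (xt : x != top H).
Let HS := (SRP HR).1.
Let rH := (SRP HR).2.
Let cH := Scvx HS.

Lemma SR_top : top H \in H /\ {in H, forall u, d r (top H) <= d r u}.
Proof. by apply: topP; rewrite -card_gt0 (Scard HS). Qed.

Lemma top_in_rem : top H \in H :\ x.
Proof. by rewrite !inE eq_sym xt SR_top.1. Qed.

Lemma rem_cvx : cvx (H :\ x). Proof. exact: cvx_rem. Qed.
Lemma rem_neq0 : H :\ x != set0.
Proof. by apply/set0Pn; exists (top H); apply: top_in_rem. Qed.
Lemma rem_r : r \notin H :\ x. Proof. by rewrite inE negb_and rH orbT. Qed.

Lemma top_rem : top (H :\ x) = top H.
Proof.
apply: top_eq; [exact: rem_cvx|exact: top_in_rem|].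
by move=> u /setD1P[_ uH]; apply: SR_top.2.
Qed.

Let p := up (H :\ x).

Lemma top_next_rem : top (next (H :\ x)) = p.
Proof. exact: top_next rem_cvx rem_neq0 rem_r. Qed.

Lemma up_rem_bd : p \in bd (H :\ x).
Proof. exact: up_bd rem_neq0 rem_r. Qed.

Lemma dist_up_rem w : w \in H :\ x -> d p w = (d (top H) w).+1.
Proof. by move=> wU; rewrite (dist_up rem_cvx rem_neq0 rem_r wU) top_rem. Qed.

Lemma ds_up_rem : ds (H :\ x) p = ds (H :\ x) (top H) + k.
Proof.
by rewrite (ds_up rem_cvx rem_neq0 rem_r) top_rem (ksets_card (Srem HS xL)).
Qed.

Lemma ds_rem u : ds H u = d u x + ds (H :\ x) u.
Proof. by rewrite -{1}(remK xL) ds_ext // !inE eqxx. Qed.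

Lemma up_rem_notin : p \notin H :\ x.
Proof. exact: bd_notin up_rem_bd. Qed.

(** Equal Wiener indices give the removed leaf and the added vertex the same distance sum to
    [H :\ x], and the latter sum exceeds that of the top by [k]. *)
Lemma SR_eq1 : next (H :\ x) \in SR -> ds H x + d (top H) x = ds H (top H) + k.
Proof.
move=> /SRP[NS _].
have e1 : wn (next (H :\ x)) = wn H by rewrite (Sw NS) (Sw HS).
have e2 := wn_ext T up_rem_notin.
have e3 : wn H = wn (H :\ x) + 2 * ds (H :\ x) x.
  by rewrite -{1}(remK xL) wn_ext // !inE eqxx.
have e5 := ds_up_rem; rewrite !ds_rem distxx; move: e1 e2 e3 e5; rewrite /next -/p.
move: (wn _) (wn _) (wn _) (ds _ _) (ds _ _) (ds _ _) (d _ _); clear; lia.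
Qed.

Lemma leaf_next y : y \in leaves H -> y != x -> y != top H ->
  y \in leaves (next (H :\ x)) /\ y != top (next (H :\ x)).
Proof.
move=> yL yx yt; have yU : y \in H :\ x by rewrite !inE yx (leaf_in yL).
have Uk := Srem HS xL; split.
  apply: (leaves_ext_sup rem_cvx (good_k Uk (rem_goods HS xL)) up_rem_bd).
    exact: leaves_rem_sub HS xL yL yx.
  by rewrite (att_up rem_cvx rem_neq0 rem_r) top_rem.
by rewrite top_next_rem; apply: contraTneq yU => ->; apply: up_rem_notin.
Qed.
End Step.

(* Comparing Wiener indices along two successive moves towards the root shows
   that the paths from the top to two movable leaves share about half of the
   vertices, whereas each move lengthens the common part. *)
Lemma SR_eq2 H x y : H \in SR -> x \in leaves H -> y \in leaves H ->
  x != top H -> y != top H -> y != x ->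
  next (H :\ x) \in SR -> next (H :\ y) \in SR -> next (next (H :\ x) :\ y) \in SR ->
  d (top H) x + d (top H) y + 2 = d x y + k.
Proof.
move=> HR xL yL xt yt yx N1 N2 N3.
have [yL1 yt1] := leaf_next HR xL xt yL yx yt.
have e1 := SR_eq1 HR yL yt N2; have e2 := SR_eq1 N1 yL1 yt1 N3.
have yU : y \in H :\ x by rewrite !inE yx (leaf_in yL).
have pU := up_rem_notin HR xt.
rewrite (top_next_rem HR xL xt) (dist_up_rem HR xL xt yU) in e2.
rewrite /next !(ds_ext _ _ pU) distxx [d y _]distC (dist_up_rem HR xL xt yU) in e2.
rewrite (ds_up_rem HR xL xt) in e2.
rewrite !(ds_rem xL) [d y x]distC in e1.
move: e1 e2; clear; lia.
Qed.

Lemma pick_leaf (A B : {set V}) : #|A| < #|B| -> exists2 x, x \in B & x \notin A.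
Proof.
move=> lt; apply/exists_inP; apply: contraTT lt; rewrite negb_exists_in => /forall_inP h.
by rewrite -leqNgt; apply/subset_leq_card/subsetP => x /h; rewrite negbK.
Qed.

Lemma not_stray P H x : x \in leaves H -> x \notin stray P H ->
  next (H :\ x) \in SR /\ next (H :\ x) \notin P.
Proof.
by move=> xL; rewrite inE xL /= negbK => /setDP.
Qed.

Lemma not_rough K P H : H \in SR -> H \notin rough K P -> 20 * #|stray P H| <= l.
Proof.
by move=> HR; rewrite inE HR /= negb_or -leqNgt => /andP[].
Qed.

Section Moves.
Variables (K1 K2 K3 : nat) (H : {set V}).
Let R1 := rough K3 set0.
Let R2 := rough K2 R1.
Let R3 := rough K1 R2.
Hypotheses (HR : H \in SR) (HN : H \notin R3).
Let HS := (SRP HR).1.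
Let t := top H.

(** Apply [SR_eq2] to [x2] and [x3] before and after moving [x1]: the top has receded by one from
    both, while their distance is the same. *)
Lemma three_moves : 3 < l \/ t \notin leaves H -> False.
Proof.
move=> cond; have s0 := not_rough HR HN.
have cardL := Sl HS.
have c2 (A B : {set V}) : #|A :|: B| <= #|A| + #|B| by apply: leq_card_setU.
have c1 x (B : {set V}) : #|x |: B| <= 1 + #|B|.
  by apply: leq_trans (c2 _ _) _; rewrite cards1.
have cT : #|leaves H :\ t| + (t \in leaves H) = l.
  by rewrite -cardL [RHS](cardsD1 t) addnC.
have [|x1 /setD1P[x1t x1L] x1s] := @pick_leaf (stray R2 H) (leaves H :\ t).
  by move: cond cT s0 l3; case: (t \in _) => -[] //; clear; lia.
have [N1 M1] := not_stray x1L x1s; set H1 := next (H :\ x1) in N1 M1.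
have s1 := not_rough N1 M1.
have [|x2 /setD1P[x2t x2L]] := @pick_leaf (x1 |: (stray R2 H :|: stray R1 H1)) (leaves H :\ t).
  have := c1 x1 (stray R2 H :|: stray R1 H1); have := c2 (stray R2 H) (stray R1 H1).
  by move: cond cT s0 s1 l3; case: (t \in _) => -[] //; clear; lia.
rewrite !in_setU1 in_setU !negb_or => /and3P[x21 x2s x2s1].
have [N2 M2] := not_stray x2L x2s; set H2 := next (H :\ x2) in N2 M2.
have s2 := not_rough N2 M2.
have [x2L1 x2t1] := leaf_next HR x1L x1t x2L x21 x2t.
have [N12 M12] := not_stray x2L1 x2s1; set H12 := next (H1 :\ x2) in N12 M12.
have s12 := not_rough N12 M12.
(* Besides [x1] and [x2], the third leaf must avoid four stray sets, which hold at most [l / 5]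
   leaves in all. *)
have [|x3 /setD1P[x3t x3L]] := @pick_leaf
  (x1 |: (x2 |: ((stray R2 H :|: stray R1 H1) :|: (stray R1 H2 :|: stray set0 H12)))) (leaves H :\ t).
  have := c1 x1 (x2 |: ((stray R2 H :|: stray R1 H1) :|: (stray R1 H2 :|: stray set0 H12))).
  have := c1 x2 ((stray R2 H :|: stray R1 H1) :|: (stray R1 H2 :|: stray set0 H12)).
  have := c2 (stray R2 H :|: stray R1 H1) (stray R1 H2 :|: stray set0 H12).
  have := c2 (stray R2 H) (stray R1 H1); have := c2 (stray R1 H2) (stray set0 H12).
  by move: cond cT s0 s1 s2 s12 l3; case: (t \in _) => -[] //; clear; lia.
rewrite !in_setU1 !in_setU !negb_or -!andbA => /and5P[x31 x32 x3s x3s1 /andP[x3s2 x3s12]].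
have [N3 _] := not_stray x3L x3s.
have [x3L1 x3t1] := leaf_next HR x1L x1t x3L x31 x3t.
have [x3L2 _] := leaf_next HR x2L x2t x3L x32 x3t.
have [N13 _] := not_stray x3L1 x3s1.
have [N23 _] := not_stray x3L2 x3s2.
have [x3L12 _] := leaf_next N1 x2L1 x2t1 x3L1 x32 x3t1.
have [N123 _] := not_stray x3L12 x3s12.
have e1 := SR_eq2 HR x2L x3L x2t x3t x32 N2 N3 N23.
have e2 := SR_eq2 N1 x2L1 x3L1 x2t1 x3t1 x32 N12 N13 N123.
have x2U : x2 \in H :\ x1 by rewrite !inE x21 (leaf_in x2L).
have x3U : x3 \in H :\ x1 by rewrite !inE x31 (leaf_in x3L).
rewrite (top_next_rem HR x1L x1t) !(dist_up_rem HR x1L x1t) // in e2.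
by move: e1 e2; move: (d _ _) (d _ _) (d _ _); clear; lia.
Qed.

(** Only two leaves can move. But moving [x1] puts a vertex above the leaf [t], which is then no
    leaf, so the constant number of leaves forces the old neighbour [w] of [x1] to become one. It
    replaces [x1] in the second use of [SR_eq2]. *)
Lemma spider_moves : l = 3 -> t \in leaves H -> False.
Proof.
move=> l_3 tL; have cardL := Sl HS.
have no_stray P K X : X \in SR -> X \notin rough K P -> stray P X = set0.
  move=> XR XN; apply/eqP; rewrite -cards_eq0; have := not_rough XR XN.
  by rewrite l_3; clear; lia.
have cT : 1 < #|leaves H :\ t|.
  by move: cardL; rewrite (cardsD1 t) tL l_3; clear; lia.
have /card_gt1P[x1 [x2 [/setD1P[x1t x1L] /setD1P[x2t x2L] x12]]] := cT.
have x21 : x2 != x1 by rewrite eq_sym.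
have [N1 M1] : next (H :\ x1) \in SR /\ next (H :\ x1) \notin R2.
  by apply: not_stray => //; rewrite (no_stray _ _ _ HR HN) inE.
have [N2 _] : next (H :\ x2) \in SR /\ next (H :\ x2) \notin R2.
  by apply: not_stray => //; rewrite (no_stray _ _ _ HR HN) inE.
set H1 := next (H :\ x1) in N1 M1.
have [x2L1 x2t1] := leaf_next HR x1L x1t x2L x21 x2t.
have [N12 M12] : next (H1 :\ x2) \in SR /\ next (H1 :\ x2) \notin R1.
  by apply: not_stray => //; rewrite (no_stray _ _ _ N1 M1) inE.
have cH := Scvx HS; have Uk := Srem HS x1L; have cU := ksets_cvx Uk.
have U2 := good_k Uk (rem_goods HS x1L).
have pU := up_rem_bd HR x1t; set p := up (H :\ x1) in pU.
have ap : att (H :\ x1) p = t.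
  rewrite (att_up cU (rem_neq0 HR x1t)) ?(top_rem HR x1L x1t) //.
  exact: rem_r HR.
set w := att H x1.
have wU : w \in leaves (H :\ x1).
  have := card_leaves_ext cU (rem_bd x1L) U2; have := card_leaves_ext cU pU U2.
  rewrite (remK x1L) (att_rem x1L) ap -/(next _) (Sl HS) (Sl (SRP N1).1).
  have -> : t \in leaves (H :\ x1) by apply: leaves_rem_sub; rewrite // eq_sym.
  by rewrite -/w; case: (w \in _) => //; clear; lia.
have wL : w \notin leaves H.
  by apply: leaf_att_notleaf; rewrite // (Scard HS) ltnS ltnW // (Sk3 HS).
have wt : w != t by apply: contraNneq wL => ->.
have wL1 : w \in leaves H1 by apply: leaves_ext_sup; rewrite // ap.
have wU' := leaf_in wU.
have wt1 : w != top H1.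
  rewrite (top_next_rem HR x1L x1t); apply: contraTneq wU' => ->.
  exact: up_rem_notin HR x1t.
have x2w : x2 != w by apply: contraNneq wL => <-.
have [N1w M1w] : next (H1 :\ w) \in SR /\ next (H1 :\ w) \notin R1.
  by apply: not_stray => //; rewrite (no_stray _ _ _ N1 M1) inE.
have [x2Lw x2tw] := leaf_next N1 wL1 wt1 x2L1 x2w x2t1.
have [N1w2 _] : next (next (H1 :\ w) :\ x2) \in SR /\ next (next (H1 :\ w) :\ x2) \notin set0.
  by apply: not_stray => //; rewrite (no_stray _ _ _ N1w M1w) inE.
have e1 := SR_eq2 HR x1L x2L x1t x2t x21 N1 N2 N12.
have e2 := SR_eq2 N1 wL1 x2L1 wt1 x2t1 x2w N1w N12 N1w2.
have x2U : x2 \in H :\ x1 by rewrite !inE x21 (leaf_in x2L).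
have tU : t \in H :\ x1 by apply: top_in_rem.
rewrite (top_next_rem HR x1L x1t) !(dist_up_rem HR x1L x1t) // in e2.
have dx u : u \in H :\ x1 -> d x1 u = (d w u).+1.
  by move=> uU; rewrite (dist_att cU (rem_bd x1L)) // (att_rem x1L).
rewrite -/t [d t x1]distC !dx // [d w t]distC in e1.
by move: e1 e2; rewrite -/t; move: (d _ _) (d _ _) (d _ _); clear; lia.
Qed.

Lemma moves_absurd : False.
Proof.
have [tL|tL] := boolP (t \in leaves H); last by apply: three_moves; right.
have [l4|l4] := ltnP 3 l; first by apply: three_moves; left.
by apply: spider_moves => //; move: l3 l4; clear; lia.
Qed.
End Moves.

(** Three levels, because the third leaf is moved after the other two. *)
Lemma rough_absurd K1 K2 K3 : SR \subset rough K1 (rough K2 (rough K3 set0)).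
Proof.
apply/subsetP => H HR; apply/negPn/negP => HN; exact: moves_absurd HR HN.
Qed.
End Rooted.

Lemma wide_starlike j : 17 * l <= 20 * m -> 1 < j -> #|wide j| <= 31 * b.
Proof.
move=> star j2; apply: leq_trans (starlike_bound star); apply: subset_leq_card.
apply/subsetP => H /setIdP[HS le]; apply/setIdP; split=> //.
by apply: leq_trans le; rewrite leq_mul2r j2 orbT.
Qed.

(** Averaging over the root: each copy contains [k + 1] vertices. *)
Lemma root_exists : 0 < #|V| ->
  exists r, #|V| * #|[set H in SS | r \in H]| <= #|SS| * k.+1.
Proof.
move=> /card_gt0P[r0 _].
have [r _ rmin] := @arg_minnP _ r0 xpredT (fun r => #|[set H in SS | r \in H]|) isT.
exists r; set c := #|[set H in SS | r \in H]|.
have -> : #|V| * c = \sum_(v : V) c by rewrite sum_nat_const.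
apply: leq_trans (_ : \sum_(v : V) #|[set H in SS | v \in H]| <= _).
  by apply: leq_sum => v _; apply: rmin.
have -> : \sum_(v : V) #|[set H in SS | v \in H]| = \sum_(H in SS) #|H|.
  transitivity (\sum_(v : V) \sum_(H in SS) (v \in H : nat)).
    apply: eq_bigr => v _; rewrite -sum1_card.
    rewrite (eq_bigl (fun H : {set V} => (H \in SS) && (v \in H))); last by move=> H; rewrite in_set.
    by rewrite big_mkcondr; apply: eq_bigr => H _; case: (v \in H).
  rewrite exchange_big; apply: eq_bigr => H _.
  by rewrite -sum1_card [RHS]big_mkcond; apply: eq_bigr => v _; case: (v \in H).
by rewrite -sum_nat_const; apply: leq_sum => H /Scard ->.
Qed.

(** * Choice of the constants *)

Section Density.
Variable R : realFieldType.
Local Open Scope ring_scope.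

(** For [C = 3000] the ratio [30 / C] in [wide_step] is [1 / 100], and [1280 * C = 3840000] leaves
    room below [4 * 10 ^+ 6] for the accumulated errors. *)
Lemma wide_small C i : C%:R = 3000 :> R ->
  #|wide (2 * C * 2 ^ i)|%:R <= #|SS|%:R / 100 ^+ i + 4 * 10 ^+ 6 * b%:R :> R.
Proof.
move=> C3; have C0 : (0 < C)%N by rewrite -(ltr0n R) C3 ltr0n.
have b0 : 0 <= b%:R :> R by [].
have [star|nstar] := leqP (17 * l) (20 * m).
  have : (#|wide (2 * C * 2 ^ i)| <= 31 * b)%N.
    apply: wide_starlike star _; apply: (leq_trans (n := (2 * 1)%N)) => //.
    by rewrite -mulnA leq_mul2l /= muln_gt0 C0 expn_gt0.
  rewrite -(ler_nat R) natrM => le1.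
  have s0 : 0 <= #|SS|%:R / 100 ^+ i :> R by rewrite divr_ge0 ?exprn_ge0 ?ler0n.
  lra.
elim: i => [|i IH].
  rewrite expr0 divr1; have : (#|wide (2 * C * 2 ^ 0)| <= #|SS|)%N.
    by apply/subset_leq_card/subsetP => H /setIdP[].
  rewrite -(ler_nat R) => le1; lra.
have := wide_step nstar C0 (K := 2 * C * 2 ^ i).
rewrite leq_pmulr ?expn_gt0 // => /(_ isT).
rewrite mulnCA -expnS -(ler_nat R) !natrD !natrM C3 exprS invfM mulrCA.
move: IH; set s := #|SS|%:R / 100 ^+ i; set w := #|wide _|%:R; set w' := #|wide _|%:R.
move=> IH le; lra.
Qed.

(** The bound for [r2] contains [r1], and that for [r3] contains [r2], with factors of order [10^6]
    and [10^5]. The exponents 8, 4, 1 make the inner sets small enough to survive them. *)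
Lemma density_arith (s c n b1 r1 r2 r3 w1 w2 w3 : R) :
  0 < s -> 0 <= n -> n * 10 ^+ 30 <= s -> c * 10 ^+ 30 <= s -> b1 <= n + c ->
  w1 <= s / 100 ^+ 1 + 4 * 10 ^+ 6 * n ->
  w2 <= s / 100 ^+ 4 + 4 * 10 ^+ 6 * n ->
  w3 <= s / 100 ^+ 8 + 4 * 10 ^+ 6 * n ->
  r1 <= w3 + 20 * (2 * 3000 * 2 ^+ 8 * (b1 + 0)) ->
  r2 <= w2 + 20 * (2 * 3000 * 2 ^+ 4 * (b1 + r1)) ->
  r3 <= w1 + 20 * (2 * 3000 * 2 ^+ 1 * (b1 + r2)) ->
  s <= c + r3 -> False.
Proof.
move=> s0 n0 n1 c1 b11 h1 h2 h3 e1 e2 e3 e4.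
have n2 : n <= s / 10 ^+ 30 by rewrite ler_pdivlMr ?exprn_gt0 ?ltr0n.
have c2 : c <= s / 10 ^+ 30 by rewrite ler_pdivlMr ?exprn_gt0 ?ltr0n.
have b2 : b1 <= 2 * s / 10 ^+ 30 by lra.
have r12 : r1 <= 2 * s / 100 ^+ 8 by lra.
have r22 : r2 <= 2 * s / 100 ^+ 4 by lra.
lra.
Qed.

Lemma family_density M : (k.+1 * M <= #|V|)%N -> 10 ^+ 30 <= M%:R :> R ->
  (0 < #|SS|)%N -> b%:R * 10 ^+ 30 <= #|SS|%:R :> R -> False.
Proof.
move=> VM M1 s0 bs; have [C C3] : exists C : nat, C%:R = 3000 :> R by exists 3000%N.
have [r rle] := root_exists (leq_ltn_trans (leq0n _) kV).
set c := #|[set H in SS | _]| in rle.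
(* At most a fraction [1 / M] of the copies contains the root. *)
have cle : (M * c <= #|SS|)%N.
  rewrite -(leq_pmul2l (ltn0Sn k)) mulnA [(k.+1 * #|SS|)%N]mulnC.
  by apply: leq_trans rle; rewrite leq_mul2r VM orbT.
have cSR : #|SS| = (c + #|SR r|)%N by apply: card_setId_compl.
pose b1 := #|ksets k.+1 :\: SR r|.
have b1le : (b1 <= b + c)%N.
  apply: leq_trans (leq_card_setU _ _); apply: subset_leq_card; apply/subsetP => X.
  case/setDP => Xk XR; apply/setUP; have [XS|XS] := boolP (X \in SS); last first.
    by left; apply/setDP.
  by right; apply/setIdP; split=> //; apply: contraNT XR => rX; apply/setIdP.
pose K i := (2 * C * 2 ^ i)%N.
pose R1 := rough r (K 8) set0; pose R2 := rough r (K 4) R1; pose R3 := rough r (K 1) R2.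
have KE i : (K i)%:R = 2 * 3000 * 2 ^+ i :> R by rewrite /K !natrM natrX C3.
have e1 : #|R1|%:R <= #|wide (K 8)|%:R + 20 * (2 * 3000 * 2 ^+ 8 * (b1%:R + 0)) :> R.
  by have := card_rough r (K 8) set0; rewrite cards0 -(ler_nat R) natrD 2!natrM natrD KE.
have e2 : #|R2|%:R <= #|wide (K 4)|%:R + 20 * (2 * 3000 * 2 ^+ 4 * (b1%:R + #|R1|%:R)) :> R.
  by have := card_rough r (K 4) R1; rewrite -(ler_nat R) natrD 2!natrM natrD KE.
have e3 : #|R3|%:R <= #|wide (K 1)|%:R + 20 * (2 * 3000 * 2 ^+ 1 * (b1%:R + #|R2|%:R)) :> R.
  by have := card_rough r (K 1) R2; rewrite -(ler_nat R) natrD 2!natrM natrD KE.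
have e4 : #|SS|%:R <= c%:R + #|R3|%:R :> R.
  by rewrite -natrD ler_nat cSR leq_add2l subset_leq_card // rough_absurd.
apply: (density_arith (s := #|SS|%:R) (c := c%:R) (n := b%:R) (b1 := b1%:R)
  _ _ bs _ _ (wide_small 1 C3) (wide_small 4 C3) (wide_small 8 C3) e1 e2 e3 e4).
- by rewrite ltr0n.
- by [].
- rewrite mulrC; apply: le_trans (_ : M%:R * c%:R <= _).
    by rewrite ler_wpM2r ?ler0n.
  by rewrite -natrM ler_nat.
- by rewrite -natrD ler_nat.
Qed.
End Density.
End Family.
End Counting.

(** * From graphs to metrics *)

Section TreeMetricOfGraph.
Variables (V : finType) (e : rel V).
Hypotheses (esym : symmetric e) (eirr : irreflexive e)
  (econn : forall x y, connect e x y)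
  (eacyclic : forall c : seq V, ucycle e c -> size c <= 2).

Definition walk i (w u : V) := [exists p : i.-tuple V, path e w p && (last w p == u)].

Lemma walkP i w u :
  reflect (exists p, [/\ path e w p, last w p = u & size p = i]) (walk i w u).
Proof.
apply: (iffP existsP) => [[p /andP[pp /eqP lp]]|[p [pp lp sp]]].
  by exists p; rewrite size_tuple.
by exists (tcast sp (in_tuple p)); rewrite val_tcast pp lp /=.
Qed.

Lemma walk_ex w u : exists i, walk i w u.
Proof. by have /connectP[p pp ->] := econn w u; exists (size p); apply/walkP; exists p. Qed.

Definition gdist w u := ex_minn (walk_ex w u).

Lemma gdist_walk w u : walk (gdist w u) w u.
Proof. by rewrite /gdist; case: ex_minnP. Qed.

Lemma gdist_le i w u : walk i w u -> gdist w u <= i.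
Proof. by rewrite /gdist; case: ex_minnP => j _; apply. Qed.

Lemma walk0 w u : walk 0 w u = (w == u).
Proof.
by apply/walkP/eqP => [[p [_ <- /size0nil ->]]|->] //; exists [::].
Qed.

Lemma walkS i w u : reflect (exists2 v, walk i w v & e v u) (walk i.+1 w u).
Proof.
apply: (iffP (walkP _ _ _)) => [[p [pp lp]]|[v /walkP[p [pp lp <-]] ev]].
  case/lastP: p => [//|p x] in pp lp *; rewrite size_rcons => -[<-].
  move: pp lp; rewrite rcons_path last_rcons => /andP[pp ex] <-.
  by exists (last w p) => //; apply/walkP; exists p.
by exists (rcons p u); rewrite rcons_path last_rcons size_rcons pp lp.
Qed.

Lemma walk_sym i w u : walk i w u -> walk i u w.
Proof.
case/walkP => p [pp lp sp]; apply/walkP; exists (rev (belast w p)).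
rewrite size_rev size_belast; split=> //; last first.
  by case: p lp {pp sp} => [|x p] //=; rewrite rev_cons last_rcons.
have := rev_path e w p; rewrite lp => ->.
by rewrite (eq_path (e' := e)) // => x y; rewrite esym.
Qed.

Lemma gdistC w u : gdist w u = gdist u w.
Proof. by apply/eqP; rewrite eqn_leq !gdist_le // walk_sym // gdist_walk. Qed.

Lemma gdist_eq0 w u : (gdist w u == 0) = (w == u).
Proof.
apply/idP/idP => [/eqP d0|]; first by rewrite -walk0 -d0 gdist_walk.
by rewrite -walk0 => /gdist_le; rewrite leqn0.
Qed.

Lemma gdist_edge1 w u v : e u v -> gdist w v <= (gdist w u).+1.
Proof. by move=> uv; apply/gdist_le/walkS; exists u => //; apply: gdist_walk. Qed.

Lemma gdist_step w u : u != w -> exists2 v, e u v & gdist w u = (gdist w v).+1.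
Proof.
rewrite eq_sym -gdist_eq0; have := gdist_walk w u.
case eg : (gdist w u) => [//|i] /walkS[v wv vu] _; exists v; first by rewrite esym.
by apply/eqP; rewrite eqn_leq -{1}eg gdist_edge1 //= ltnS gdist_le.
Qed.

Lemma gedgeE u v : e u v = (gdist u v == 1).
Proof.
apply/idP/eqP => [uv|d1].
  have := gdist_edge1 u uv; have := gdist_eq0 u u; rewrite eqxx => /eqP -> le.
  apply/eqP; rewrite eqn_leq le /= lt0n gdist_eq0.
  by apply: contraTneq uv => ->; rewrite eirr.
by have := gdist_walk u v; rewrite d1 => /walkS[x]; rewrite walk0 => /eqP ->.
Qed.

Definition erestr (X : {set V}) : rel V := fun u v => [&& u \in X, v \in X & e u v].

Lemma erestr_sym X : connect_sym (erestr X).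
Proof. by apply: sym_connect_sym => u v; rewrite /erestr esym andbCA. Qed.

(** A path in [X] from [a] to [c] without repetitions, closed up through [y], would be a cycle. *)
Lemma no_detour (X : {set V}) y a c : y \notin X -> a \in X -> e y a -> e y c ->
  connect (erestr X) a c -> a = c.
Proof.
move=> yX aX ya yc /connectP[p0 pp0 lp0]; apply/eqP/negPn/negP => ac.
case/shortenP: pp0 lp0 => p pp up _ lp.
have pX : all [in X] p.
  elim: p a aX pp {ya up lp ac p0} => //= x p IH a aX /andP[/and3P[_ xX _] pp].
  by rewrite xX (IH x).
have pe : path e a p by apply: sub_path pp => u v /and3P[].
have uc : ucycle e [:: y, a & p].
  rewrite /ucycle /ucycleb /= ya rcons_path pe -lp esym yc /=.
  rewrite -[(a \notin p) && uniq p]/(uniq (a :: p)) up andbT inE negb_or.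
  apply/andP; split; first by apply: contraNneq yX => ->.
  by apply: contra yX => /(allP pX).
by have := eacyclic uc; case: p lp {pp up pX pe uc} => //= ac'; rewrite ac' eqxx in ac.
Qed.

Lemma ball_connect w i u : gdist w u <= i ->
  connect (erestr [set x | gdist w x <= i]) w u.
Proof.
have [n] := ubnP (gdist w u); elim: n => // n IH in u *; rewrite ltnS => dn di.
have [->|uw] := eqVneq u w; first exact: connect0.
have [v uv dv] := gdist_step uw; have vi : gdist w v <= i.
  by apply: leq_trans di; rewrite dv.
apply: connect_trans (IH v _ vi) (connect1 _); first by rewrite -dv.
by rewrite /erestr !inE vi di esym.
Qed.

(** Both neighbours lie in the largest ball around [w] that misses [u], and balls are connected. *)
Lemma gdist_uniq w u v v' : e u v -> e u v' ->
  gdist w u = (gdist w v).+1 -> gdist w u = (gdist w v').+1 -> v = v'.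
Proof.
move=> uv uv' d1 d2; have dd : gdist w v' = gdist w v.
  by apply/eqP; rewrite -eqSS -d2 d1.
apply: (@no_detour [set x | gdist w x <= gdist w v] u); rewrite ?inE //.
  by rewrite d1 ltnn.
apply: (connect_trans (y := w)); last by rewrite ball_connect // dd.
by rewrite erestr_sym ball_connect.
Qed.

(** If not, the ball just below [u] and [v], enlarged by [u], would join the two neighbours [u] and
    [c] of [v] without using [v]. *)
Lemma gdist_neq w u v : e u v -> gdist w u != gdist w v.
Proof.
move=> uv; apply/eqP => dd.
have uw : u != w.
  apply: contraTneq uv => uw; move/eqP: dd; rewrite uw.
  have /eqP -> : gdist w w == 0 by rewrite gdist_eq0.
  by rewrite eq_sym gdist_eq0 => /eqP <-; rewrite eirr.
have vw : v != w by rewrite eq_sym -gdist_eq0 -dd gdist_eq0 eq_sym.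
have [a ua da] := gdist_step uw; have [c vc dc] := gdist_step vw.
have ac : gdist w a = gdist w c by apply/eqP; rewrite -eqSS -da dd dc.
pose X := u |: [set x | gdist w x <= gdist w a].
suff : u = c by move=> uc; move: da; rewrite uc ac => /eqP; rewrite -[_ == _]/(_ == _) eqn_leq ltnn andbF.
have sub x y : erestr [set x | gdist w x <= gdist w a] x y -> connect (erestr X) x y.
  by move=> /and3P[xX yX xy]; apply: connect1; rewrite /erestr !in_setU1 xX yX xy !orbT.
apply: (@no_detour X v); rewrite ?setU11 //.
- rewrite !inE negb_or -ltnNge -dd da leqnn andbT.
  by apply: contraTneq uv => ->; rewrite eirr.
- by rewrite esym.
apply: (connect_trans (y := a)).
  by apply: connect1; rewrite /erestr ua setU11 in_setU1 inE leqnn orbT.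
apply: (connect_trans (y := w)).
  by rewrite erestr_sym; apply: (connect_sub sub); apply: ball_connect.
by apply: (connect_sub sub); apply: ball_connect; rewrite ac.
Qed.

Lemma gdist_edge w u v : e u v ->
  gdist w u = (gdist w v).+1 \/ gdist w v = (gdist w u).+1.
Proof.
move=> uv; have := gdist_neq w uv; have := gdist_edge1 w uv.
have vu : e v u by rewrite esym.
by have := gdist_edge1 w vu; clear; lia.
Qed.

Definition tree_metric_of : tree_metric V :=
  TreeMetric gdist_eq0 gdistC gedgeE gdist_edge gdist_step gdist_uniq.
End TreeMetricOfGraph.

(** * Trees with at most two leaves *)

Section Path.
Variables (V : finType) (T : tree_metric V) (X : {set V}).
Local Notation e := (edge T).
Local Notation d := (dist T).
Hypotheses (cX : cvx T X) (X1 : 1 < #|X|) (lX : #|leaves T X| <= 2).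

Lemma deg_le2 u : u \in X -> deg T X u + (u \in leaves T X) <= 2.
Proof.
move=> uX; have := sum_deg_leaf cX (ltnW X1); rewrite (bigD1 u) //=.
have : \sum_(i in X | i != u) 2 <=
    \sum_(i in X | i != u) (deg T X i + (i \in leaves T X)).
  by apply: leq_sum => i /andP[iX _]; apply: deg_leaf_ge2.
have eX : #|X| = 1 + \sum_(i in X | i != u) 1 by rewrite -sum1_card (bigD1 u).
have -> : \sum_(i in X | i != u) 2 = 2 * \sum_(i in X | i != u) 1.
  by rewrite big_distrr /=; apply: eq_bigr.
move: lX eX; set s' := \sum_(i in X | _) 1; set s := \sum_(i in X | _) _.
by move: (_ \in _) => c; clear; lia.
Qed.

Variable x0 : V.
Hypothesis x0L : x0 \in leaves T X.
Let x0X : x0 \in X. Proof. exact: leaf_in x0L. Qed.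

(** Two vertices at equal distance from [x0] share their predecessor by induction; it would have
    three neighbours, or two if it is the leaf [x0]. *)
Lemma path_inj : {in X &, injective (d x0)}.
Proof.
move=> u v; have [n] := ubnP (d x0 u); elim: n => // n IH in u v *.
rewrite ltnS => dn uX vX dd.
have [u0|u0] := eqVneq u x0.
  by apply/esym/eqP; rewrite u0 eq_sym -(dist_eq0 T) -dd u0 distxx.
have v0 : v != x0.
  by rewrite eq_sym -(dist_eq0 T) -dd dist_eq0 eq_sym.
have [eu du] := stepP T u0; have [ev dv] := stepP T v0.
have suX := cvxP _ _ cX x0 u x0X uX u0; have svX := cvxP _ _ cX x0 v x0X vX v0.
have ss : step T x0 u = step T x0 v.
  by apply: IH => //; [rewrite -du|apply/eqP; rewrite -eqSS -du dd dv].
rewrite -ss in ev dv; set c := step T x0 u in eu du suX ev dv.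
apply/eqP/negPn/negP => uv; have := deg_le2 suX.
have [c0|c0] := eqVneq c x0.
  have /leavesP[_ d1] := x0L; have := nbr1_uniq d1 uX vX.
  by rewrite -c0 edge_sym eu edge_sym ev => /(_ isT isT)/eqP; rewrite (negPf uv).
have [ec dc] := stepP T c0; have scX := cvxP _ _ cX x0 c x0X suX c0.
have scu : step T x0 c != u by apply/eqP => h; move: dc; rewrite h du; clear; lia.
have scv : step T x0 c != v by apply/eqP => h; move: dc; rewrite h dv; clear; lia.
have /subset_leq_card : [set step T x0 c; u; v] \subset nbr T X c.
  rewrite !subUset !sub1set !in_nbr scX ec uX vX.
  by rewrite edge_sym eu edge_sym ev.
rewrite -setUA cardsU1 cards2 uv in_set2 negb_or scu scv /= /deg.
by move: #|_| (_ \in _) => a c'; clear; lia.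
Qed.

Lemma path_dist_lt u : u \in X -> d x0 u < #|X|.
Proof.
move=> uX; apply: (leq_trans (n := #|[set w in X | d x0 w <= d x0 u]|)); last first.
  by apply/subset_leq_card/subsetP => w /setIdP[].
have [n] := ubnP (d x0 u); elim: n => // n IH in u uX *; rewrite ltnS => dn.
have [->|u0] := eqVneq u x0.
  by rewrite distxx; apply/card_gt0P; exists x0; rewrite inE x0X distxx.
have [eu du] := stepP T u0; have sX := cvxP _ _ cX x0 u x0X uX u0.
rewrite (cardsD1 u) inE uX leqnn /= add1n ltnS {1}du.
apply: leq_trans (IH _ sX _) _; first by rewrite -du.
apply: subset_leq_card; apply/subsetP => w /setIdP[wX le].
apply/setD1P; split; first by apply: contraTneq le => ->; rewrite du ltnn.
by apply/setIdP; split; rewrite // du leqW.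
Qed.

Lemma path_edge u v : u \in X -> v \in X ->
  e u v = (d x0 u == (d x0 v).+1) || (d x0 v == (d x0 u).+1).
Proof.
have key a c : a \in X -> c \in X -> d x0 a = (d x0 c).+1 -> e a c.
  move=> aX cX' da; have a0 : a != x0 by rewrite eq_sym -(dist_eq0 T) da.
  have [ea d1] := stepP T a0; have sX := cvxP _ _ cX x0 a x0X aX a0.
  by rewrite -(path_inj sX cX') //; apply/eqP; rewrite -eqSS -d1 da.
move=> uX vX; apply/idP/orP => [uv|[/eqP h|/eqP h]].
- by have [->|->] := dist_edge x0 uv; rewrite eqxx; [left|right].
- exact: key.
- by rewrite edge_sym; apply: key.
Qed.
End Path.

(** * Subtrees of a graph as convex vertex sets *)

Section Graph.
Variables (V : finType) (G : sgraph V).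
Hypotheses (treeG : is_tree G) (fullG : vset G = [set: V]).

Lemma adj_sym (W : finType) (H : sgraph W) : symmetric (adj H).
Proof. by move=> x y; rewrite /adj setUC. Qed.

Lemma adj_irr (W : finType) (H : sgraph W) : simple_graph H -> irreflexive (adj H).
Proof.
move=> sH x; apply/negP => xx; have := forall_inP sH _ xx.
by rewrite setUid cards1.
Qed.

Lemma tree_connect x y : connect (adj G) x y.
Proof. by have [_ [_ h] _] := treeG; apply: h; rewrite fullG inE. Qed.

Lemma tree_simple : simple_graph G. Proof. by case: treeG. Qed.
Lemma tree_acyclic : acyclic_graph G. Proof. by case: treeG. Qed.

Lemma metric_exists : {M : tree_metric V | edge M = adj G}.
Proof.
by exists (tree_metric_of (adj_sym G) (adj_irr tree_simple) tree_connect tree_acyclic).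
Qed.

Definition metric : tree_metric V := sval metric_exists.

Lemma metric_edge : edge metric = adj G.
Proof. exact: (svalP metric_exists). Qed.

Definition induced (X : {set V}) : sgraph V := (X, [set s in eset G | s \subset X]).

Lemma induced_adj X x y : adj (induced X) x y = [&& adj G x y, x \in X & y \in X].
Proof. by rewrite /adj /induced /eset /= in_set subUset !sub1set. Qed.

Lemma induced_subtree X : cvx metric X -> X != set0 -> subtree (induced X) G.
Proof.
move=> cX X0; have [/forall_inP sG _ aG] := treeG; split.
  apply/andP; split; first by rewrite fullG subsetT.
  by apply/subsetP => s; rewrite inE => /andP[].
split.
- apply/forall_inP => s; rewrite inE => /andP[sE sX].
  by have /andP[-> _] := sG s sE.
- split=> // x y xX yX; have [n] := ubnP (dist metric x y).
  elim: n => // n IH in y yX *; rewrite ltnS => dn.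
  have [->|yx] := eqVneq y x; first exact: connect0.
  have [e1 d1] := stepP metric yx; have sX := cvxP _ _ cX x y xX yX yx.
  apply: connect_trans (IH _ sX _) (connect1 _); first by rewrite -d1.
  by rewrite induced_adj sX yX -metric_edge edge_sym e1.
- move=> c uc; apply: aG; case/andP: uc => cc uc; apply/andP; split=> //.
  by case: c cc {uc} => //= x p; apply: sub_path => a b; rewrite induced_adj => /and3P[].
Qed.

(** Along a walk of [H] from [w], the path of [G] back to [w] stays in [H]: each step either adds an
    edge of [H] to this path or removes one. The invariant [P] records this edge by edge. *)
Lemma subtree_cvx (H : sgraph V) : subtree H G ->
  [/\ cvx metric (vset H), vset H != set0 & H = induced (vset H)].
Proof.
case: H => X E [/andP[/= XG EG]] [sH [X0 conn] _]; rewrite /vset /= in X0 conn *.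
have adjG x y : adj (X, E) x y -> edge metric x y.
  by rewrite metric_edge; apply: (subsetP EG).
have adjX x y : adj (X, E) x y -> y \in X.
  move=> /(forall_inP sH)/andP[_ /subsetP]; apply; by rewrite !inE eqxx orbT.
pose P w u := forall j, j < dist metric w u ->
  adj (X, E) (iter j (step metric w) u) (iter j.+1 (step metric w) u).
have PP w u : w \in X -> u \in X -> P w u.
  move=> wX uX; have /connectP[p pp ->] := conn w u wX uX.
  elim/last_ind: p pp {uX} => [_ j|p x IH]; first by rewrite /= distxx.
  rewrite rcons_path last_rcons => /andP[pp ax]; have Pl := IH pp.
  set l := last w p in ax Pl; have lx := adjG _ _ ax.
  have [dd|dd] := dist_edge w lx.
    have s1 := stepE lx dd; move=> j jd; have := Pl j.+1.
    by rewrite dd ltnS !iterSr s1 -iterSr => /(_ jd).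
  have xl : edge metric x l by rewrite edge_sym.
  have s1 := stepE xl dd; case=> [_|j]; first by rewrite /= s1 adj_sym.
  by rewrite dd ltnS => jd; rewrite !iterSr s1 -iterSr; apply: Pl.
have cX : cvx metric X.
  apply/cvxP => w u wX uX uw; have [_ d1] := stepP metric uw.
  by have := PP w u wX uX 0; rewrite d1 => /(_ isT) /adjX.
split=> //; congr (_, _); apply/setP => s; rewrite inE.
apply/idP/andP => [sE|[sE sX]].
  by split; [exact: (subsetP EG s sE) | have /andP[] := forall_inP sH s sE].
have [/forall_inP sG _ _] := treeG; have /andP[/cards2P[x [y [xy es]]] _] := sG s sE.
move: sX sE; rewrite es subUset !sub1set => /andP[xX yX] sE.
have exy : edge metric y x by rewrite edge_sym metric_edge.
have := PP x y xX yX 0; rewrite /= (step_self exy) adj_sym distC (edge_dist exy).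
exact.
Qed.

Lemma induced_inj : injective induced.
Proof. by move=> X Y []. Qed.

Lemma card_Z k : 0 < k -> Z k G = #|ksets metric k|.
Proof.
move=> k0; rewrite /Z -(card_imset _ induced_inj); apply: eq_card => H.
rewrite inE; apply/andP/imsetP => [[/asboolP sH /eqP kH]|[X /ksetsP[cX kX] ->]].
  have [cH H0 eH] := subtree_cvx sH; exists (vset H) => //.
  by apply/ksetsP.
split; last by rewrite /= kX.
by apply/asboolP/induced_subtree; rewrite // -card_gt0 kX.
Qed.

Section Copies.
Variables (W : finType) (S : sgraph W).
Hypotheses (treeS : is_tree S) (nstarS : ~ is_star S) (npathS : ~ is_path S).

Definition copies := [set X in ksets metric #|vset S| | `[< isomorphic S (induced X) >]].

Lemma vset_gt0 : 0 < #|vset S|.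
Proof. by have [_ [S0 _] _] := treeS; rewrite card_gt0. Qed.

Lemma card_embeddings : #|embeddings S G| = #|copies|.
Proof.
rewrite -(card_imset _ induced_inj); apply: eq_card => H.
rewrite inE; apply/asboolP/imsetP => [[sH iH]|[X /setIdP[/ksetsP[cX kX] /asboolP iX] ->]].
  have [cH H0 eH] := subtree_cvx sH; exists (vset H) => //.
  rewrite eH in iH; apply/setIdP; split; last exact/asboolP.
  apply/ksetsP; split=> //; case: iH => f [fi fX _].
  by rewrite -(card_in_imset fi) fX.
by split=> //; apply: induced_subtree; rewrite // -card_gt0 kX vset_gt0.
Qed.

Lemma copies_iso X : X \in copies ->
  exists f : W -> V, [/\ {in vset S &, injective f}, f @: vset S = X
    & {in vset S &, forall x y, adj S x y = edge metric (f x) (f y)}].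
Proof.
case/setIdP => _ /asboolP[f [fi fX fa]]; exists f; split=> // x y xS yS.
rewrite fa // induced_adj metric_edge.
have fm z : z \in vset S -> f z \in X by move=> zS; rewrite -[X]fX imset_f.
by rewrite !fm // !andbT.
Qed.

Lemma copies_same X Y : X \in copies -> Y \in copies -> iso metric X Y.
Proof.
move=> /copies_iso[f [fi fX fa]] /copies_iso[g [gi gY ga]].
pose h v := if [pick w in vset S | f w == v] is Some w then g w else v.
have hf w : w \in vset S -> h (f w) = g w.
  move=> wS; rewrite /h; case: pickP => [w' /andP[w'S /eqP /fi ->] //|/(_ w)].
  by rewrite wS eqxx.
exists h; split.
- move=> u v; rewrite -fX => /imsetP[a aS ->] /imsetP[c cS ->].
  by rewrite !hf // => /gi ->.
- rewrite -gY -fX -imset_comp; apply: eq_in_imset => w wS; exact: hf.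
- move=> u v; rewrite -fX => /imsetP[a aS ->] /imsetP[c cS ->].
  by rewrite !hf // -fa // ga.
Qed.

Lemma copies_nonstar X : X \in copies -> nonstar metric X.
Proof.
move=> /copies_iso[f [fi fX fa]]; apply/negP => /exists_inP[v].
rewrite -fX => /imsetP[x xS ->] /forall_inP h; apply: nstarS; split=> //.
exists x => // y yS yx; rewrite fa //.
by apply: (implyP (h (f y) (imset_f _ yS))); apply: contraNneq yx => /fi ->.
Qed.

(** With at most two leaves, the distances to a leaf [x0] would number the vertices as in
    [path_graph]. *)
Lemma copies_leaves X : X \in copies -> 2 < #|leaves metric X|.
Proof.
move=> XC; rewrite ltnNge; apply/negP => lX; apply: npathS.
have /setIdP[/ksetsP[cX kX] _] := XC; have nX := copies_nonstar XC.
have X1 : 1 < #|X|.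
  by apply: ltn_trans (nonstar_card cX nX _); rewrite ?kX ?vset_gt0.
have [x0 x0L] := leaf_exists cX X1.
have [f [fi fX fa]] := copies_iso XC.
have fm z : z \in vset S -> f z \in X by move=> zS; rewrite -fX imset_f.
have [y0 y0S] : exists y, y \in vset S by apply/set0Pn; rewrite -card_gt0 vset_gt0.
pose k := #|vset S|; have dk y : y \in vset S -> dist metric x0 (f y) < k.
  by move=> yS; rewrite /k -kX; apply: path_dist_lt => //; apply: fm.
pose r y : 'I_k := insubd (Ordinal (dk y0 y0S)) (dist metric x0 (f y)).
have rE y : y \in vset S -> r y = dist metric x0 (f y) :> nat.
  by move=> yS; rewrite /r val_insubd dk.
have rinj : {in vset S &, injective r}.
  move=> y z yS zS /(congr1 val); rewrite /= !rE // => dd.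
  apply: fi => //; exact: (path_inj cX X1 lX x0L (fm _ yS) (fm _ zS) dd).
have rsurj : r @: vset S = [set: 'I_k].
  by apply/eqP; rewrite eqEcard subsetT cardsT card_ord (card_in_imset rinj) leqnn.
pose F i := odflt y0 [pick y in vset S | r y == i].
have FP i : F i \in vset S /\ r (F i) = i.
  rewrite /F; case: pickP => [y /andP[yS /eqP]//|no] /=.
  have /imsetP[y yS ey] : i \in r @: vset S by rewrite rsurj inE.
  by move: (no y); rewrite yS ey eqxx.
exists k, F; split.
- by move=> i j _ _ eF; rewrite -(FP i).2 eF (FP j).2.
- apply/setP => y; apply/imsetP/idP => [[i _ ->]|yS]; first exact: (FP i).1.
  by exists (r y); rewrite ?inE //; apply: rinj; rewrite ?(FP (r y)).1 ?(FP (r y)).2.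
- move=> i j _ _; have [iS ri] := FP i; have [jS rj] := FP j.
  rewrite fa // (path_edge cX X1 lX x0L (fm _ iS) (fm _ jS)) -!rE // ri rj.
  apply/imsetP/orP => [[[a c]]|[/eqP h|/eqP h]].
  + rewrite inE /= => /eqP ca eS.
    have : i \in [set a; c] by rewrite -eS set21.
    have : j \in [set a; c] by rewrite -eS set22.
    have : c \in [set i; j] by rewrite eS set22.
    have : a \in [set i; j] by rewrite eS set21.
    rewrite !in_set2 => /orP[/eqP ai|/eqP aj] /orP[/eqP ci|/eqP cj] _ _.
    * by move: ca; rewrite ai ci; clear; lia.
    * by right; rewrite -cj -ai ca.
    * by left; rewrite -ci -aj ca.
    * by move: ca; rewrite aj cj; clear; lia.
  + by exists (j, i); rewrite ?inE /= ?h // setUC.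
  + by exists (i, j); rewrite ?inE /= ?h.
Qed.

Lemma copies_density (R : realFieldType) M :
  (#|vset S| * M + #|vset S|.+1 <= #|V|)%N -> (10 ^+ 30 <= M%:R :> R)%R ->
  (0 < #|copies|)%N ->
  (#|ksets metric #|vset S| :\: copies|%:R * 10 ^+ 30 <= #|copies|%:R :> R)%R -> False.
Proof.
move=> VM M1 C0; have /card_gt0P[X XC] := C0.
have CK : copies \subset ksets metric #|vset S| by apply/subsetP => Y /setIdP[].
have cC Y : Y \in copies -> cvx metric Y by case/(subsetP CK)/ksetsP.
have inv (T : eqType) (F : {set V} -> T) :
    (forall A B h, cvx metric A -> cvx metric B -> {in A &, injective h} -> h @: A = B ->
      {in A &, forall u v, edge metric (h u) (h v) = edge metric u v} -> F B = F A) ->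
    {in copies, forall Y, F Y = F X}.
  by move=> FI Y YC; have [h [h1 h2 h3]] := copies_same XC YC; apply: FI h1 h2 h3; apply: cC.
have SlX : {in copies, forall Y, #|leaves metric Y| = #|leaves metric X|}.
  by apply: inv => A B h cA cB; apply: iso_card_leaves.
have SqX : {in copies, forall Y, qs metric Y = qs metric X}.
  by apply: inv => A B h cA cB; apply: iso_qs.
have SwX : {in copies, forall Y, wn metric Y = wn metric X}.
  by apply: inv => A B h cA cB; apply: iso_wn.
have SmX : {in copies, forall Y, mx metric Y = mx metric X}.
  by apply: inv => A B h cA cB; apply: iso_mx.
have kE : #|vset S| = #|vset S|.-1.+1 by rewrite prednK ?vset_gt0.
rewrite kE in VM CK *; apply: (family_density CK SlX SqX SwX SmX copies_nonstar
  (copies_leaves XC) _ _ M1 C0); first by apply: leq_trans VM; rewrite leq_addl.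
by apply: leq_trans VM; rewrite leq_addr.
Qed.
End Copies.
End Graph.

Lemma density_le (R : realType) (V W : finType) (S : sgraph V) (G : sgraph W) M :
  is_tree S -> ~ is_star S -> ~ is_path S -> is_tree G -> vset G = [set: W] ->
  (#|vset S| * M + #|vset S|.+1 <= #|W|)%N -> (10 ^+ 30 <= M%:R :> R)%R ->
  (density R S G <= 1 - 10 ^- 35)%R.
Proof.
move=> tS sS pS tG fG VM M1.
have p35 : (0 < 10 ^+ 35 :> R)%R by rewrite exprn_gt0 ?ltr0n.
have c0 : (0 <= 1 - 10 ^- 35 :> R)%R.
  by rewrite subr_ge0 invf_le1 // exprn_ege1 // ler1n.
rewrite /density; case: ifP => _ //.
rewrite (card_embeddings tG fG tS) (card_Z tG fG (vset_gt0 tS)).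
set K := ksets _ _; set C := copies _ _ _.
(* Without subtrees of this size the quotient is 0, by the convention on division by zero. *)
have [->|K0] := posnP #|K|; first by rewrite invr0 mulr0.
rewrite ler_pdivrMr ?ltr0n // leNgt; apply/negP => lt.
have KC : #|K| = (#|C| + #|K :\: C|)%N.
  rewrite -(cardsID C K) (setIidPr _) //; by apply/subsetP => X /setIdP[].
have C0 : (0 < #|C|)%N.
  rewrite -(ltr0n R); apply: le_lt_trans lt; by rewrite mulr_ge0 ?ler0n.
apply: (@copies_density _ _ tG fG _ _ tS sS pS _ _ VM M1 C0); rewrite -/K -/C.
move: lt; rewrite KC natrD mulrBl mul1r ltrBlDr -ltrBlDl.
set c : R := (#|C|%:R)%R; set b : R := (#|_|%:R)%R => lt.
have b0 : (0 <= b)%R by rewrite ler0n.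
have c00 : (0 <= c)%R by rewrite ler0n.
(* The slack between the exponents 35 and 30 absorbs the [b] on the right. *)
have : (b * 10 ^+ 35 <= c + b)%R.
  rewrite mulrC -ler_pdivlMl //; apply: ltW; apply: le_lt_trans lt; lra.
lra.
Qed.

Theorem theorem12 (R : realType) (V : finType) (S : sgraph V) :
  is_tree S -> ~ is_star S -> ~ is_path S ->
  (inducibility R S <= (1 - 10 ^- 35)%:E)%E.
Proof.
move=> tS sS pS; have [M M1] : exists M : nat, (10 ^+ 30 <= M%:R :> R)%R.
  by exists (10 ^ 30)%N; rewrite natrX.
pose n0 := (#|vset S| * M + #|vset S|.+1)%N.
rewrite /inducibility /limn_esup /limf_esup.
(* The limsup is an infimum of suprema over eventual sets; from [n0] on, the tree is large enough
   compared with [S] for [density_le]. *)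
pose A : classical_sets.set nat := fun n => (n0 <= n)%N.
apply: (@le_trans _ _ (ereal_sup (classical_sets.image A (fun n => (max_density R S n)%:E)))).
  by apply: ereal_inf_lbound; exists A => //; exists n0.
apply: ge_ereal_sup => _ [n /= nn0 <-]; rewrite lee_fin.
apply: bigmax_le => [|G /andP[/asboolP tG /eqP fG]].
  by rewrite subr_ge0 invf_le1 ?exprn_gt0 ?ltr0n // exprn_ege1 // ler1n.
by apply: (density_le tS sS pS tG fG _ M1); rewrite card_ord.
Qed.
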